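(* Let $\Gamma=(m_{i,j})_{i,j\in I}$ be a Coxeter matrix of affine type $\tilde A_n$ ($n\ge 2$), $\tilde D_n$ ($n\ge 4$) or $\tilde E_n$ ($n=6,7,8$), let $\mathfrak R$ be a commutative unitary ring, let $(\mathfrak b,\mathfrak c,\mathfrak d)\in(\mathfrak R^\times)^3$, and let $\mathscr F$ be the $\mathfrak R$-module of LK-families relatively to $(\mathfrak b,\mathfrak c,\mathfrak d)$. Let $i_0,j_0\in I$ with $m_{i_0,j_0}=3$. Then the $\mathfrak R$-linear map $\mu:\mathscr F\to\mathfrak R^{\mathbb N}$, $(f_i)_{i\in I}\mapsto(\mathfrak f_n)_{n\in\mathbb N}$, defined by $$\mathfrak f_{2p}=f_{i_0}(e_{p\delta+\alpha_{i_0}})\quad(p\ge 0),$$ $$\mathfrak f_{2p-1}=\mathfrak c\mathfrak d\, f_{i_0}(e_{p\delta-\alpha_{i_0}})-\mathfrak b\mathfrak c\, f_{i_0}(e_{p\delta-\alpha_{i_0}-\alpha_{j_0}})-\mathfrak d^2 f_{j_0}(e_{p\delta-\alpha_{i_0}-\alpha_{j_0}})\quad(p\ge 1),$$ is an isomorphism of $\mathfrak R$-modules.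
   Context: A Coxeter matrix of small type is $\Gamma=(m_{i,j})_{i,j\in I}$ with $I$ finite, $m_{i,j}=m_{j,i}\in\{1,2,3\}$ and $m_{i,j}=1\Leftrightarrow i=j$ (the types in the claim are small). Let $E=\bigoplus_{i\in I}\mathbb R\alpha_i$ with the symmetric bilinear form $(\alpha_i|\alpha_j)=-2\cos(\pi/m_{i,j})$. The Coxeter group $W$ of $\Gamma$, with generators $s_i$ ($i\in I$), acts on $E$ by $s_i(\beta)=\beta-(\beta|\alpha_i)\alpha_i$. Put $\Phi=\{w(\alpha_i)\mid w\in W,i\in I\}$, $\Phi^+$ = the elements of $\Phi$ with non-negative coordinates in $(\alpha_i)$, $\Phi^-=-\Phi^+$. The depth of $\alpha\in\Phi^+$ is $\mathrm{dp}(\alpha)=\min\{l(w)\mid w\in W,\ w(\alpha)\in\Phi^-\}$, with $l$ the word length with respect to the $s_i$. In the affine case, $\delta$ denotes the first positive imaginary root: the vector $\delta=\sum_{i\in I}n_i\alpha_i$ with coprime positive integer coefficients spanning the radical of $(\cdot|\cdot)$. The vectors $p\delta+\alpha_i$ ($p\ge0$), and $p\delta-\alpha_i$, $p\delta-\alpha_i-\alpha_j$ ($p\ge1$, $m_{i,j}=3$) belong to $\Phi^+$. $V$ is the free $\mathfrak R$-module with basis $(e_\alpha)_{\alpha\in\Phi^+}$, $V^\star$ its dual. Set $\mathfrak a=\mathfrak d-\mathfrak b\mathfrak c/\mathfrak d$. For $i\in I$, $\varphi_i$ is the endomorphism of $V$ given by: $\varphi_i(e_{\alpha_i})=0$; $\varphi_i(e_\alpha)=\mathfrak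 d e_\alpha$ if $s_i(\alpha)=\alpha$; and if $\alpha,\beta\in\Phi^+$, $\beta=s_i(\alpha)$, $\mathrm{dp}(\beta)>\mathrm{dp}(\alpha)$, then $\varphi_i(e_\beta)=\mathfrak b e_\alpha$ and $\varphi_i(e_\alpha)=\mathfrak a e_\alpha+\mathfrak c e_\beta$. An LK-family relatively to $(\mathfrak b,\mathfrak c,\mathfrak d)$ is a family $(f_i)_{i\in I}\in(V^\star)^I$ such that: $f_i(e_{\alpha_j})=0$ for $i\ne j$; $f_i\varphi_j=\mathfrak d f_i$ whenever $m_{i,j}=2$; $f_i\varphi_j=f_j\varphi_i$ whenever $m_{i,j}=3$. These form a submodule $\mathscr F$ of $(V^\star)^I$. *)

(* Defs.v *)
From HB Require Import structures.
From mathcomp Require Import all_boot all_order all_algebra fingroup generic_quotient.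
From mathcomp Require Import all_classical all_reals all_analysis.
From mathcomp Require Import ring lra.

Set Implicit Arguments.
Unset Strict Implicit.
Unset Printing Implicit Defensive.

Import Order.TTheory GRing.Theory Num.Theory.

Local Open Scope classical_set_scope.
Local Open Scope quotient_scope.
Local Open Scope ring_scope.

(* The least element of A; 0 if A is empty. *)
Definition nat_min (A : set nat) : nat :=
  xget 0%N [set k | A k /\ forall j, A j -> (k <= j)%N].

(* Only small type: the entries are 1, 2 or 3. *)
Record coxeter_matrix (I : finType) := CoxeterMatrix {
  cox_m :> I -> I -> nat;
  cox_m_sym : forall i j, cox_m i j = cox_m j i;
  cox_m_small : forall i j, cox_m i j \in [:: 1; 2; 3]%N;
  cox_m_diag : forall i j, cox_m i j = 1%N <-> i = j
}.

(* Affine diagrams, with vertices 0, ..., n and Bourbaki's labelling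
   (0 is the additional vertex); an edge is an unordered pair, listed once. *)
Definition edges_A (n : nat) : seq (nat * nat) :=
  (0%N, n) :: [seq (k, k.+1) | k <- iota 0 n].

Definition edges_D (n : nat) : seq (nat * nat) :=
  (0, 2)%N :: (n - 2, n)%N :: [seq (k, k.+1) | k <- iota 1 (n - 2)].

Definition edges_E6 : seq (nat * nat) :=
  [:: (1, 3); (3, 4); (4, 5); (5, 6); (2, 4); (0, 2)]%N.

Definition edges_E7 : seq (nat * nat) :=
  [:: (0, 1); (1, 3); (3, 4); (4, 5); (5, 6); (6, 7); (2, 4)]%N.

Definition edges_E8 : seq (nat * nat) :=
  [:: (1, 3); (3, 4); (4, 5); (5, 6); (6, 7); (7, 8); (8, 0); (2, 4)]%N.

(* The matrix m is, up to a relabelling h of the vertices, the simply laced one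
   with diagram given by the list of edges r on {0, ..., n}. *)
Definition has_diagram (I : finType) (m : coxeter_matrix I) (n : nat)
    (r : seq (nat * nat)) : Prop :=
  exists2 h : I -> 'I_n.+1, bijective h &
    forall i j, m i j =
      if i == j then 1%N
      else if ((val (h i), val (h j)) \in r) || ((val (h j), val (h i)) \in r)
      then 3%N else 2%N.

Inductive affine_ADE (I : finType) (m : coxeter_matrix I) : Prop :=
| AffineA n of (2 <= n)%N & has_diagram m n (edges_A n)
| AffineD n of (4 <= n)%N & has_diagram m n (edges_D n)
| AffineE6 of has_diagram m 6 edges_E6
| AffineE7 of has_diagram m 7 edges_E7
| AffineE8 of has_diagram m 8 edges_E8.

Section CoxeterGroup.
Variables (I : finType) (m : coxeter_matrix I).

(* The congruence on words generated by (s_i s_j)^(m i j) = 1. Since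
   m i i = 1, it contains s_i s_i = 1, so that no inverse letter is needed. *)
Inductive cox_cong : seq I -> seq I -> Prop :=
| Cong_refl u : cox_cong u u
| Cong_sym u v : cox_cong u v -> cox_cong v u
| Cong_trans v u w : cox_cong u v -> cox_cong v w -> cox_cong u w
| Cong_rel u v i j :
    cox_cong (u ++ flatten (nseq (m i j) [:: i; j]) ++ v) (u ++ v).

Definition cox_congb : rel (seq I) := fun u v => `[< cox_cong u v >].

Lemma cox_congb_refl : reflexive cox_congb.
Proof. by move=> u; apply/asboolP; exact: Cong_refl. Qed.

Lemma cox_congb_sym : symmetric cox_congb.
Proof.
by move=> u v; apply/asboolP/asboolP => h; apply: Cong_sym.
Qed.

Lemma cox_congb_trans : transitive cox_congb.
Proof.
by move=> v u w /asboolP h1 /asboolP h2; apply/asboolP; apply: Cong_trans h2.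
Qed.

Canonical cox_cong_equiv :=
  EquivRel cox_congb cox_congb_refl cox_congb_sym cox_congb_trans.

Definition coxeter_group := {eq_quot cox_congb}.
HB.instance Definition _ := Choice.on coxeter_group.
HB.instance Definition _ := EqQuotient.on coxeter_group.

Definition word (u : seq I) : coxeter_group := \pi_coxeter_group u.

Lemma wordP u v : word u = word v <-> cox_cong u v.
Proof.
split=> [/eqP|h]; first by rewrite eqmodE => /asboolP.
by apply/eqP; rewrite eqmodE; apply/asboolP.
Qed.

Lemma word_repr w : word (repr w) = w. Proof. exact: reprK. Qed.

Lemma cong_catr u v w : cox_cong u v -> cox_cong (u ++ w) (v ++ w).
Proof.
elim=> {u v} [u|u v _ h|v u x _ h1 _ h2|u v i j]; first exact: Cong_refl.
- exact: Cong_sym.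
- exact: Cong_trans h2.
- by rewrite -!catA; apply: Cong_rel.
Qed.

Lemma cong_catl u v w : cox_cong u v -> cox_cong (w ++ u) (w ++ v).
Proof.
elim=> {u v} [u|u v _ h|v u x _ h1 _ h2|u v i j]; first exact: Cong_refl.
- exact: Cong_sym.
- exact: Cong_trans h2.
- by rewrite !catA -(catA (w ++ u)); apply: Cong_rel.
Qed.

Definition cox_one : coxeter_group := word [::].
Definition cox_mul (w1 w2 : coxeter_group) : coxeter_group :=
  word (repr w1 ++ repr w2).
Definition cox_inv (w : coxeter_group) : coxeter_group := word (rev (repr w)).

Lemma cox_mulE u v : cox_mul (word u) (word v) = word (u ++ v).
Proof.
apply/wordP/(@Cong_trans (u ++ repr (word v))).
  by apply: cong_catr; apply/wordP; rewrite word_repr.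
by apply: cong_catl; apply/wordP; rewrite word_repr.
Qed.

Lemma cox_mulA : associative cox_mul.
Proof.
move=> x y z; rewrite -(word_repr x) -(word_repr y) -(word_repr z).
by rewrite !cox_mulE catA.
Qed.

Lemma cox_mul1 : left_id cox_one cox_mul.
Proof. by move=> x; rewrite -(word_repr x) cox_mulE. Qed.

Lemma cox_mulr1 : right_id cox_one cox_mul.
Proof. by move=> x; rewrite -(word_repr x) cox_mulE cats0. Qed.

Lemma cong_square u v i : cox_cong (u ++ [:: i; i] ++ v) (u ++ v).
Proof.
have := Cong_rel u v i i.
by have -> : m i i = 1%N by apply/cox_m_diag.
Qed.

Lemma cong_rev u : cox_cong (rev u ++ u) [::].
Proof.
elim: u => [|i u IH]; first exact: Cong_refl.
rewrite rev_cons -cats1 -catA.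
exact: Cong_trans (cong_square (rev u) u i) IH.
Qed.

Lemma cox_mulV : left_inverse cox_one cox_inv cox_mul.
Proof.
move=> x; rewrite -{2}(word_repr x) cox_mulE.
by apply/wordP/cong_rev.
Qed.

Lemma cox_mulrV : right_inverse cox_one cox_inv cox_mul.
Proof.
move=> x; rewrite -{1}(word_repr x) cox_mulE.
by apply/wordP; rewrite -{1}(revK (repr x)); apply: cong_rev.
Qed.

HB.instance Definition _ := isGroup.Build coxeter_group
  cox_mulA cox_mul1 cox_mulr1 cox_mulV cox_mulrV.

Definition cox_gen (i : I) : coxeter_group := word [:: i].

Definition cox_length (w : coxeter_group) : nat :=
  nat_min [set k | exists2 u : seq I,
    size u = k & w = (\prod_(i <- u) cox_gen i)%g].

End CoxeterGroup.

Lemma cos_pithird (K : realType) : cos (pi / 3) = 2^-1 :> K.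
Proof.
set t : K := pi / 3.
have t0 : 0 < t by rewrite divr_gt0 ?pi_gt0.
have c0 : 0 < cos t by apply: cos_gt0_pihalf; have := pi_gt0 K; rewrite /t; lra.
have : cos (t *+ 2 + t) = -1.
  by rewrite -mulrSr /t -[_ *+ 3]mulr_natr divfK ?cospi ?pnatr_eq0.
rewrite cosD cos_mulr2n sin_mulr2n => h.
have e : (cos t + 1) * (2 * cos t - 1) ^+ 2 = 0.
  have := sin2cos2 t => s2.
  have -> : (cos t + 1) * (2 * cos t - 1) ^+ 2 =
    1 + ((cos t ^+ 2 *+ 2 - 1) * cos t - 2 * cos t * (1 - cos t ^+ 2)) by ring.
  rewrite -s2.
  have -> : 2 * cos t * sin t ^+ 2 = cos t * sin t *+ 2 * sin t by ring.
  by rewrite h subrr.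
move/eqP: e; rewrite mulf_eq0 expf_eq0 /= => /orP[/eqP|/eqP]; lra.
Qed.

Section Roots.
Variables (K : realType) (I : finType) (m : coxeter_matrix I).

Definition rootspace := {ffun I -> K^o}.
HB.instance Definition _ := GRing.Lmodule.on rootspace.

Implicit Types x y : rootspace.

Definition simple_root (i : I) : rootspace := [ffun j => (i == j)%:R].

Definition cox_form x y : K :=
  \sum_i \sum_j x i * y j * (- (2 * cos (pi / (m i j)%:R))).

Definition reflection (i : I) x : rootspace := x - cox_form x (simple_root i) *: simple_root i.

Definition act_word (u : seq I) x : rootspace := foldr reflection x u.

(* The choice of the representative is irrelevant, see act_gen and actM. *)
Definition cox_act (w : coxeter_group m) x : rootspace := act_word (repr w) x.

Lemma form_simple x i :
  cox_form x (simple_root i) = \sum_k x k * (- (2 * cos (pi / (m k i)%:R))).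
Proof.
apply: eq_bigr => k _; rewrite (bigD1 i) //= big1 => [|j /negPf ji].
  by rewrite addr0 ffunE eqxx mulr1.
by rewrite ffunE eq_sym ji mulr0 mul0r.
Qed.

Lemma formDZ a b x y z i :
  cox_form (x + a *: y + b *: z) (simple_root i) =
  cox_form x (simple_root i) + a * cox_form y (simple_root i)
    + b * cox_form z (simple_root i).
Proof.
rewrite !form_simple !big_distrr -!big_split /=; apply: eq_bigr => k _.
by rewrite !ffunE -![_ *: _]/(_ * _); ring.
Qed.

Lemma form_simple2 i j :
  cox_form (simple_root i) (simple_root j) = - (2 * cos (pi / (m i j)%:R)).
Proof.
rewrite form_simple (bigD1 i) //= big1 => [|k /negPf ki].
  by rewrite addr0 ffunE eqxx mul1r.
by rewrite ffunE eq_sym ki mul0r.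
Qed.

Lemma form_m1 i j : m i j = 1%N -> cox_form (simple_root i) (simple_root j) = 2.
Proof. by move=> e; rewrite form_simple2 e divr1 cospi; ring. Qed.

Lemma form_m2 i j : m i j = 2%N -> cox_form (simple_root i) (simple_root j) = 0.
Proof. by move=> e; rewrite form_simple2 e cos_pihalf; ring. Qed.

Lemma form_m3 i j : m i j = 3%N -> cox_form (simple_root i) (simple_root j) = -1.
Proof.
by move=> e; rewrite form_simple2 e cos_pithird mulfV ?pnatr_eq0.
Qed.

Lemma act_word_rel i j x :
  act_word (flatten (nseq (m i j) [:: i; j])) x = x.
Proof.
have mii : m i i = 1%N by apply/cox_m_diag.
have mjj : m j j = 1%N by apply/cox_m_diag.
set A := simple_root i; set B := simple_root j.
have E0 : x = x + 0 *: A + 0 *: B by rewrite !scale0r !addr0.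
have refA a b : reflection i (x + a *: A + b *: B) =
    x + (a - (cox_form x A + a * cox_form A A + b * cox_form B A)) *: A + b *: B.
  rewrite /reflection formDZ scalerBl !addrA; apply/ffunP => k; rewrite !ffunE; ring.
have refB a b : reflection j (x + a *: A + b *: B) =
    x + a *: A + (b - (cox_form x B + a * cox_form A B + b * cox_form B B)) *: B.
  rewrite /reflection formDZ scalerBl !addrA; apply/ffunP => k; rewrite !ffunE; ring.
have fAA : cox_form A A = 2 by exact: form_m1.
have fBB : cox_form B B = 2 by exact: form_m1.
have mji : m j i = m i j by exact: cox_m_sym.
have := cox_m_small m i j; rewrite !inE => /or3P[] /eqP e;
  rewrite e /act_word /= {1}E0 !(refA, refB) fAA fBB.
- have ij : i = j by apply/(cox_m_diag m).
  have -> : cox_form A B = 2 by exact: form_m1.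
  have -> : cox_form B A = 2 by apply: form_m1; rewrite mji.
  rewrite /A /B -ij; apply/ffunP => k; rewrite !ffunE -![_ *: _]/(_ * _); ring.
- have -> : cox_form A B = 0 by exact: form_m2.
  have -> : cox_form B A = 0 by apply: form_m2; rewrite mji.
  rewrite [RHS]E0; congr (_ + _ *: _ + _ *: _); ring.
- have -> : cox_form A B = -1 by exact: form_m3.
  have -> : cox_form B A = -1 by apply: form_m3; rewrite mji.
  rewrite [RHS]E0; congr (_ + _ *: _ + _ *: _); ring.
Qed.

Lemma act_word_cong u v : cox_cong m u v -> act_word u =1 act_word v.
Proof.
elim=> {u v} [u|u v _ h|v u w _ h1 _ h2|u v i j] x //.
- by rewrite h1 h2.
- rewrite /act_word !foldr_cat; congr (foldr _ _ _).
  exact: act_word_rel.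
Qed.

Lemma actE u x : cox_act (word m u) x = act_word u x.
Proof. by apply: act_word_cong; apply/wordP; rewrite word_repr. Qed.

Lemma act_gen i x : cox_act (cox_gen m i) x = reflection i x.
Proof. exact: actE. Qed.

Lemma act1 x : cox_act 1%g x = x.
Proof. exact: actE. Qed.

Lemma actM w1 w2 x : cox_act (w1 * w2)%g x = cox_act w1 (cox_act w2 x).
Proof. by rewrite [LHS]actE /act_word foldr_cat. Qed.

Definition roots : set rootspace :=
  [set x | exists w i, x = cox_act w (simple_root i)].

Definition pos_roots : set rootspace :=
  [set x | roots x /\ forall i, (0 : K) <= x i].

Definition neg_roots : set rootspace := [set x | pos_roots (- x)].

Definition depth x : nat :=
  nat_min [set cox_length w | w in [set w | neg_roots (cox_act w x)]].

Definition first_imaginary_root (delta : rootspace) : Prop :=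
  exists n : I -> nat,
    [/\ forall i, (0 < n i)%N,
        \big[gcdn/0%N]_i n i = 1%N,
        delta = \sum_i simple_root i *+ n i &
        forall x, (forall y, cox_form x y = 0) <-> exists r : K, x = r *: delta].

Definition pos_root : Type := {x : rootspace | x \in pos_roots}.
HB.instance Definition _ := Choice.on pos_root.

End Roots.

Section FreeModule.
Variables (R : comPzRingType) (X : choiceType).

Definition finsupp : {pred X -> R^o} :=
  fun v => `[< finite_set [set x | v x <> 0] >].

Lemma finsupp_submod : submod_closed finsupp.
Proof.
split=> [|a u v /asboolP hu /asboolP hv]; apply/asboolP.
  by rewrite (_ : [set _ | _] = set0) //; apply/seteqP; split=> x //=.
apply: (@sub_finite_set _ _ ([set x | u x <> 0] `|` [set x | v x <> 0])).
  move=> x /= h; apply: contrapT => /not_orP[/contrapT ux /contrapT vx].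
  by apply: h; rewrite -[LHS]/(a * u x + v x) ux vx mulr0 addr0.
by rewrite finite_setU.
Qed.
HB.instance Definition _ := GRing.isSubmodClosed.Build R (X -> R^o) finsupp
  finsupp_submod.

Record freemod := Freemod { freemod_val :> X -> R^o; _ : freemod_val \in finsupp }.
HB.instance Definition _ := [isSub for freemod_val].
HB.instance Definition _ := [Choice of freemod by <:].
HB.instance Definition _ := [SubChoice_isSubLmodule of freemod by <:].

Lemma basis_elt_subproof (x : X) : (fun y => (x == y)%:R : R^o) \in finsupp.
Proof.
apply/asboolP; apply: (@sub_finite_set _ _ [set x]); last exact: finite_set1.
by move=> y /=; case: eqP => // _ h; case: h.
Qed.

Definition basis_elt (x : X) : freemod := Freemod (basis_elt_subproof x).

(* The linear map from the free module to U sending basis_elt x to g x. *)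
Definition linear_ext (U : lmodType R) (g : X -> U) (v : freemod) : U :=
  \sum_(x \in [set: X]) (v x : R) *: g x.

Lemma linear_extE (U : lmodType R) (g : X -> U) (v : freemod) (s : seq X) :
  uniq s -> (forall x, v x <> 0 -> x \in s) ->
  linear_ext g v = \sum_(x <- s) (v x : R) *: g x.
Proof.
move=> us hs; rewrite /linear_ext (fsbigE s) //; first by apply: eq_bigl => x; rewrite in_setT.
move=> x _ /negP xs; have [-> | /eqP/hs //] := eqVneq (v x) 0.
by rewrite scale0r.
Qed.

Lemma linear_ext_basis (U : lmodType R) (g : X -> U) (x : X) :
  linear_ext g (basis_elt x) = g x.
Proof.
rewrite (@linear_extE _ _ _ [:: x]) // => [|y /=].
  by rewrite big_seq1 /= eqxx scale1r.
by rewrite inE eq_sym; case: eqP => // _ h; case: h.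
Qed.

Lemma linear_ext_linear (U : lmodType R) (g : X -> U) : linear (linear_ext g).
Proof.
move=> a u v.
have /asboolP/finite_seqP[A hA] := valP u.
have /asboolP/finite_seqP[B hB] := valP v.
have E x : (a *: u + v) x = a * u x + v x by [].
pose s := undup (A ++ B).
have hu x : u x <> 0 -> x \in s.
  move=> h; rewrite mem_undup mem_cat; apply/orP; left.
  by have : [set` A] x by rewrite -hA.
have hv x : v x <> 0 -> x \in s.
  move=> h; rewrite mem_undup mem_cat; apply/orP; right.
  by have : [set` B] x by rewrite -hB.
rewrite !(@linear_extE _ _ _ s) ?undup_uniq //.
  rewrite scaler_sumr -big_split; apply: eq_bigr => x _.
  by rewrite E scalerDl -scalerA.
move=> x h; case: (pselect (u x = 0)) => [ux|]; last exact: hu.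
by apply: hv => vx; apply: h; rewrite E ux vx mulr0; exact: addr0.
Qed.

HB.instance Definition _ (U : lmodType R) (g : X -> U) :=
  GRing.isLinear.Build R freemod U _ (linear_ext g) (linear_ext_linear g).

End FreeModule.

(* R is allowed to be the zero ring, hence is not a unitRingType. *)
Record unit_elt (R : comPzRingType) := UnitElt {
  unit_val :> R;
  unit_inv : R;
  unit_valV : unit_val * unit_inv = 1
}.

Section LKFamilies.
Variables (K : realType) (I : finType) (m : coxeter_matrix I).
Variables (R : comPzRingType) (ub uc ud : unit_elt R).

Local Notation b := (unit_val ub).
Local Notation c := (unit_val uc).
Local Notation d := (unit_val ud).

Local Notation alpha := (@simple_root K I).
Local Notation s := (@reflection K I m).
Local Notation dp := (@depth K I m).

Definition LKmod := freemod R (pos_root K m).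
HB.instance Definition _ := GRing.Lmodule.on LKmod.

(* The basis vector e_x for x in Phi^+, extended by 0 to the whole of E. *)
Definition evec (x : rootspace K I) : LKmod :=
  if insub x is Some r then basis_elt R (r : pos_root K m) else 0.

Definition coef_a : R := d - b * c * unit_inv ud.

(* The depths of x and s i x never agree in the remaining case; the last
   branch is only there to make the definition total. *)
Definition phi_basis (i : I) (r : pos_root K m) : LKmod :=
  let x := val r in
  if x == alpha i then 0
  else if s i x == x then d *: evec x
  else if (dp x < dp (s i x))%N then coef_a *: evec x + c *: evec (s i x)
  else if (dp (s i x) < dp x)%N then b *: evec (s i x)
  else 0.

Definition phi (i : I) : LKmod -> LKmod := linear_ext (phi_basis i).
HB.instance Definition _ (i : I) := GRing.Linear.on (phi i).

Definition LK_conditions (f : I -> LKmod -> R^o) : Prop :=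
  [/\ forall i, linear (f i),
      forall i j, i <> j -> f i (evec (alpha j)) = 0,
      forall i j, m i j = 2%N -> f i \o phi j = d *: f i &
      forall i j, m i j = 3%N -> f i \o phi j = f j \o phi i].

Definition LK_pred : {pred I -> LKmod -> R^o} := fun f => `[< LK_conditions f >].

Lemma LK_submod : submod_closed LK_pred.
Proof.
split=> [|r f g /asboolP[lf f1 f2 f3] /asboolP[lg g1 g2 g3]]; apply/asboolP.
  have Z i v : (0 : I -> LKmod -> R^o) i v = 0 by [].
  split=> [i a u v|i j _|i j _|i j _].
  - by rewrite !Z scaler0 addr0.
  - exact: Z.
  - by apply/funext => v; rewrite [LHS]Z; apply/esym/scaler0.
  - by apply/funext => v; rewrite [LHS]Z [RHS]Z.
have E i v : (r *: f + g) i v = r *: (f i v : R^o) + g i v by [].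
split=> [i a u v|i j ij|i j ij|i j ij].
- rewrite !E lf lg !scalerDr !scalerA (mulrC r a) !addrA; congr (_ + _).
  by rewrite -!addrA; congr (_ + _); rewrite addrC.
- by rewrite E f1 // g1 // scaler0 addr0.
- apply/funext => v; rewrite [LHS]E.
  have -> : f i (phi j v) = d *: (f i v : R^o) by rewrite -[LHS]/((f i \o phi j) v) f2.
  have -> : g i (phi j v) = d *: (g i v : R^o) by rewrite -[LHS]/((g i \o phi j) v) g2.
  rewrite [RHS](_ : _ = d *: ((r *: f + g) i v : R^o)) // E scalerDr !scalerA.
  by rewrite (mulrC r d).
- apply/funext => v; rewrite [LHS]E [RHS]E.
  have -> : f i (phi j v) = f j (phi i v) by rewrite -[LHS]/((f i \o phi j) v) f3.
  by have -> : g i (phi j v) = g j (phi i v) by rewrite -[LHS]/((g i \o phi j) v) g3.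
Qed.
HB.instance Definition _ := GRing.isSubmodClosed.Build R (I -> LKmod -> R^o) LK_pred
  LK_submod.

Record LK_family := LKFamily { LK_val :> I -> LKmod -> R^o; _ : LK_val \in LK_pred }.
HB.instance Definition _ := [isSub for LK_val].
HB.instance Definition _ := [Choice of LK_family by <:].
HB.instance Definition _ := [SubChoice_isSubLmodule of LK_family by <:].

(* mu_even p is the term of index 2p, and mu_odd p (p > 0) that of index
   2p - 1. *)
Definition mu_even (delta : rootspace K I) (i0 : I) (f : LK_family) (p : nat) : R :=
  f i0 (evec (delta *+ p + alpha i0)).

Definition mu_odd (delta : rootspace K I) (i0 j0 : I) (f : LK_family) (p : nat) : R :=
  c * d * f i0 (evec (delta *+ p - alpha i0))
  - b * c * f i0 (evec (delta *+ p - alpha i0 - alpha j0))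
  - d ^+ 2 * f j0 (evec (delta *+ p - alpha i0 - alpha j0)).

Definition mu (delta : rootspace K I) (i0 j0 : I) (f : LK_family) : nat -> R^o :=
  fun n => if odd n then mu_odd delta i0 j0 f n.+1./2
           else mu_even delta i0 f n./2.

End LKFamilies.

Arguments mu {K I} m {R} ub uc ud delta i0 j0 f.

(* Main.v *)
(* Rescaling f_i(e_x) by (b/d)^(depth of x) turns the maps phi_i / d into the
   generators of a Hecke algebra with the single parameter t = bc/d^2, acting on
   the permutation module of all real roots; LK-families become the equivariant
   families of functions on the whole set of real roots that vanish on the
   negative ones. Written on the orbits of the rank two parabolic subgroups, the
   relations express the value g_i(x) in terms of values at roots of smaller
   height, except when x = p delta + alpha_i, where g_i(x) only depends on p, and
   when x = p delta - alpha_i, where g_i(x) minus a combination of lower values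
   only depends on p. Hence a family is determined by two sequences, and these are,
   up to units, the even and the odd terms of mu. Conversely, prescribing the two
   sequences defines the values by recursion on the height, provided that any two
   relations giving g_i(x) agree. This confluence is checked by cases on the
   rank three configurations; A2~, whose diagram is a triangle, is special.

   Only the radical is used, not the classification: the roots are the vectors of
   norm 2 of the root lattice, and two roots with inner product 2 differ by a
   multiple of delta. *)
Require Import Defs.
From mathcomp Require Import all_boot all_order all_algebra.
From mathcomp Require Import all_classical all_reals all_analysis.
From mathcomp Require Import zify ring lra.

Set Implicit Arguments.
Unset Strict Implicit.
Unset Printing Implicit Defensive.

Import Order.TTheory GRing.Theory Num.Theory.

Local Open Scope ring_scope.

(** * The affine root lattice *)

(** The real geometry is replaced by this integral data. Since [radicalE] asks for an integral
    multiple of [delta], it encodes the coprimality of the coefficients of [delta]. *)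
Record affine_cartan (I : finType) := AffineCartan {
  cartan : I -> I -> int;
  delta : {ffun I -> int};
  cartanC : forall i j, cartan i j = cartan j i;
  cartan_diag : forall i, cartan i i = 2;
  cartan_off : forall i j, i != j -> cartan i j = 0 \/ cartan i j = -1;
  delta_gt0 : forall i, 0 < delta i;
  delta_rad : forall k, \sum_j delta j * cartan j k = 0;
  radicalE : forall x : {ffun I -> int}, (forall k, \sum_j x j * cartan j k = 0) ->
    exists p : int, x = delta *~ p
}.

Section AffineLattice.
Variables (I : finType) (L : affine_cartan I).

Local Notation A := (cartan L).
Local Notation delta := (delta L).
Local Notation Q := {ffun I -> int}.
Implicit Types (x y : Q) (i j k : I).

Definition unitv (i : I) : Q := [ffun j => (i == j)%:R].

Definition pairing (x : Q) (k : I) : int := \sum_j x j * A j k.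
Local Notation pr := pairing.

Definition bform (x y : Q) : int := \sum_k y k * pr x k.

Definition simple_refl (k : I) (x : Q) : Q := x - unitv k *~ pr x k.

Definition lattice_root (x : Q) : Prop := bform x x = 2.

Definition posv (x : Q) : Prop := forall i, 0 <= x i.

Definition height (x : Q) : int := \sum_i x i.

Local Notation e := unitv.
Local Notation refl := simple_refl.
Local Notation is_root := lattice_root.

Lemma prD x y k : pr (x + y) k = pr x k + pr y k.
Proof. by rewrite -big_split; apply: eq_bigr => j _; rewrite ffunE mulrDl. Qed.

Lemma prN x k : pr (- x) k = - pr x k.
Proof. by rewrite -sumrN; apply: eq_bigr => j _; rewrite ffunE mulNr. Qed.

Lemma ffunMzE x (z : int) j : (x *~ z) j = x j * z.
Proof.
by case: z => n; rewrite ?NegzE ?mulrNz -?pmulrn !(ffunE, ffunMnE) ?mulrN -mulr_natr natz.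
Qed.

Lemma prMz x (z : int) k : pr (x *~ z) k = pr x k * z.
Proof. rewrite /pr mulr_suml; apply: eq_bigr => j _; rewrite ffunMzE; ring. Qed.

Lemma pr_unitv i k : pr (e i) k = A i k.
Proof.
rewrite /pr (bigD1 i) //= big1 => [|j ji]; first by rewrite ffunE eqxx mul1r addr0.
by rewrite ffunE eq_sym (negPf ji) mul0r.
Qed.

Definition prE := (prD, prN, prMz, pr_unitv).

Lemma bform_unitv x k : bform x (e k) = pr x k.
Proof.
rewrite /bform (bigD1 k) //= big1 => [|j ji]; first by rewrite ffunE eqxx mul1r addr0.
by rewrite ffunE eq_sym (negPf ji) mul0r.
Qed.

Lemma bformC x y : bform x y = bform y x.
Proof.
rewrite /bform /pr.
under eq_bigr do rewrite big_distrr.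
rewrite exchange_big; apply: eq_bigr => j _; rewrite big_distrr.
by apply: eq_bigr => k _ /=; rewrite (cartanC L j k); ring.
Qed.

Lemma bformDl x y z : bform (x + y) z = bform x z + bform y z.
Proof. by rewrite -big_split; apply: eq_bigr => k _; rewrite prD mulrDr. Qed.

Lemma bformNl x z : bform (- x) z = - bform x z.
Proof. by rewrite -sumrN; apply: eq_bigr => k _; rewrite prN mulrN. Qed.

Lemma bformMzl x z (n : int) : bform (x *~ n) z = bform x z * n.
Proof. by rewrite /bform mulr_suml; apply: eq_bigr => k _; rewrite prMz; ring. Qed.

Lemma bformDr x y z : bform z (x + y) = bform z x + bform z y.
Proof. by rewrite bformC bformDl !(bformC z). Qed.

Lemma bformNr x z : bform z (- x) = - bform z x.
Proof. by rewrite bformC bformNl (bformC z). Qed.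

Lemma bformMzr x z (n : int) : bform z (x *~ n) = bform z x * n.
Proof. by rewrite bformC bformMzl (bformC z). Qed.

Definition bformE :=
  (bformDl, bformDr, bformNl, bformNr, bformMzl, bformMzr, bform_unitv, pr_unitv).

Lemma bform0r x : bform x 0 = 0.
Proof. by rewrite /bform big1 // => k _; rewrite ffunE mul0r. Qed.

Lemma bform0l x : bform 0 x = 0.
Proof. by rewrite bformC bform0r. Qed.

Lemma root_unitv i : is_root (e i).
Proof. by rewrite /is_root !bformE cartan_diag. Qed.

Lemma root_opp x : is_root x -> is_root (- x).
Proof. by rewrite /is_root !bformE opprK. Qed.

Lemma bform_refl k x y : bform (refl k x) (refl k y) = bform x y.
Proof.
rewrite /refl !bformE (bformC (e k) y) bform_unitv cartan_diag.
ring.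
Qed.

Lemma root_refl k x : is_root x -> is_root (refl k x).
Proof. by rewrite /is_root bform_refl. Qed.

Lemma pr_refl k x j : pr (refl k x) j = pr x j - A k j * pr x k.
Proof. by rewrite /refl !prE. Qed.

Lemma reflK k : involutive (refl k).
Proof.
move=> x; rewrite {1}/refl pr_refl cartan_diag /refl; apply/ffunP => j.
by rewrite !(ffunE, ffunMzE); ring.
Qed.

Lemma refl_unitv k : refl k (e k) = - e k.
Proof.
rewrite /refl pr_unitv cartan_diag.
by apply/ffunP => j; rewrite !(ffunE, ffunMzE); ring.
Qed.

Lemma refl_opp k x : refl k (- x) = - refl k x.
Proof. by rewrite /refl prN; apply/ffunP => j; rewrite !(ffunE, ffunMzE); ring. Qed.

Lemma heightD x y : height (x + y) = height x + height y.
Proof. by rewrite -big_split; apply: eq_bigr => j _; rewrite ffunE. Qed.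

Lemma heightMz x (z : int) : height (x *~ z) = height x * z.
Proof. by rewrite /height mulr_suml; apply: eq_bigr => j _; rewrite ffunMzE. Qed.

Lemma heightN x : height (- x) = - height x.
Proof. by rewrite -sumrN; apply: eq_bigr => j _; rewrite ffunE. Qed.

Lemma height_unitv i : height (e i) = 1.
Proof.
rewrite /height (bigD1 i) //= big1 => [|j ji]; first by rewrite ffunE eqxx addr0.
by rewrite ffunE eq_sym (negPf ji).
Qed.

(** Evenness is what forces one of the two parts in [root_posv_or_negv] to have norm 0. *)
Lemma bform_even x : exists z : int, bform x x = 2 * z.
Proof.
have -> : x = \sum_i e i *~ x i.
  apply/ffunP => j; rewrite sum_ffunE (bigD1 j) //= big1 => [|i ij].
    by rewrite ffunMzE ffunE eqxx mul1r addr0.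
  by rewrite ffunMzE ffunE (negPf ij) mul0r.
apply: (big_ind (fun y => exists z : int, bform y y = 2 * z)).
- by exists 0; rewrite /bform big1 // => k _; rewrite ffunE mul0r.
- move=> y y' [z hz] [z' hz']; exists (z + z' + bform y y').
  by rewrite !bformE hz hz' (bformC y' y); ring.
- by move=> i _; exists (x i * x i); rewrite !bformE cartan_diag; ring.
Qed.

#[local] Hint Resolve delta_gt0 : core.

Lemma pr_delta k : pr delta k = 0.
Proof. exact: delta_rad. Qed.

Lemma sum_delta_pr x : \sum_k delta k * pr x k = 0.
Proof.
rewrite -[LHS]/(bform x delta) bformC /bform big1 // => k _.
by rewrite pr_delta mulr0.
Qed.

(** * Semidefiniteness of the form and its consequences for roots *)

Lemma cartan_le0 i j : i != j -> A i j <= 0.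
Proof. by move=> /(cartan_off L)[->|->]. Qed.

(** When the squares are expanded, the terms in [y i ^+ 2] and in [y j ^+ 2] sum to 0 because
    [delta] is in the radical, and the mixed terms give the form. The weights with [i != j] are
    non-negative, so the form is positive semidefinite. *)
Lemma bform_squares x (y := fun i => (x i)%:Q / (delta i)%:Q) :
  \sum_i \sum_j (- (A i j * delta i * delta j)%:Q) * (y i - y j) ^+ 2
    = 2 * (bform x x)%:Q.
Proof.
have nz i : (delta i)%:Q != 0 by rewrite intr_eq0 gt_eqF.
have xE i : (x i)%:Q = (delta i)%:Q * y i by rewrite /y mulrC divfK.
have zero : \sum_i \sum_j (A i j * delta i * delta j)%:Q * y i ^+ 2 = 0.
  apply: big1 => i _; rewrite -mulr_suml -rmorph_sum /=.
  suff -> : \sum_j A i j * delta i * delta j = pr delta i * delta i by rewrite pr_delta !mul0r.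
  by rewrite /pr mulr_suml; apply: eq_bigr => j _; rewrite (cartanC L j i); ring.
have zero' : \sum_i \sum_j (A i j * delta i * delta j)%:Q * y j ^+ 2 = 0.
  rewrite exchange_big -[RHS]zero; apply: eq_bigr => i _; apply: eq_bigr => j _.
  by rewrite (cartanC L j i) -!mulrA (mulrC (delta i)).
have bE : (bform x x)%:Q =
    \sum_i \sum_j (A i j * delta i * delta j)%:Q * (y i * y j).
  rewrite /bform rmorph_sum; apply: eq_bigr => i _.
  rewrite rmorphM /pr rmorph_sum big_distrr; apply: eq_bigr => j _ /=.
  by rewrite !rmorphM /= !xE (cartanC L j i); ring.
transitivity (2 * (bform x x)%:Q -
    \sum_i \sum_j (A i j * delta i * delta j)%:Q * y i ^+ 2 -
    \sum_i \sum_j (A i j * delta i * delta j)%:Q * y j ^+ 2); last first.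
  by rewrite zero zero' !subr0.
rewrite bE big_distrr -!sumrB; apply: eq_bigr => i _.
rewrite big_distrr -!sumrB; apply: eq_bigr => j _ /=; ring.
Qed.

Lemma square_term_ge0 x (y := fun i => (x i)%:Q / (delta i)%:Q) i j :
  0 <= (- (A i j * delta i * delta j)%:Q) * (y i - y j) ^+ 2.
Proof.
have [->|ij] := eqVneq i j; first by rewrite subrr expr0n mulr0.
rewrite mulr_ge0 ?sqr_ge0 // -rmorphN ler0z oppr_ge0 -mulrA mulr_le0_ge0 ?cartan_le0 //.
by rewrite mulr_ge0 ?ltW.
Qed.

Lemma bform_ge0 x : 0 <= bform x x.
Proof.
have : 0 <= 2 * (bform x x)%:Q.
  by rewrite -bform_squares; apply: sumr_ge0 => i _; apply: sumr_ge0 => j _; exact: square_term_ge0.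
by rewrite pmulr_rge0 // ler0z.
Qed.

(** Every term of [bform_squares] vanishes, so [y] is constant along edges. In the row of [k] it can
    be replaced by [y k], which makes the pairing of [x] with [k] a multiple of that of [delta]. *)
Lemma bform_eq0 x : bform x x = 0 -> exists p : int, x = delta *~ p.
Proof.
move=> x0; apply: radicalE => k.
pose y i := (x i)%:Q / (delta i)%:Q.
have nz i : (delta i)%:Q != 0 by rewrite intr_eq0 gt_eqF.
have xE i : (x i)%:Q = (delta i)%:Q * y i by rewrite /y mulrC divfK.
have yy j : A j k != 0 -> y j = y k.
  move=> Ajk; have [->//|jk] := eqVneq j k.
  have /eqP := bform_squares x; rewrite x0 mulr0 psumr_eq0 => [|i _]; last first.
    by apply: sumr_ge0 => l _; exact: square_term_ge0.
  move=> /allP/(_ j (mem_index_enum j))/=.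
  rewrite psumr_eq0 => [|l _]; last exact: square_term_ge0.
  move=> /allP/(_ k (mem_index_enum k))/=.
  rewrite mulf_eq0 oppr_eq0 intr_eq0 !mulf_eq0 (negPf Ajk).
  rewrite (gt_eqF (delta_gt0 L j)) (gt_eqF (delta_gt0 L k)) /= -/(y j) -/(y k).
  by rewrite orbb subr_eq0 => /eqP.
apply/eqP; rewrite -(intr_eq0 rat) /pr rmorph_sum /=.
have -> : \sum_i (x i * A i k)%:Q = y k * (pr delta k)%:Q.
  rewrite /pr rmorph_sum big_distrr; apply: eq_bigr => j _ /=.
  rewrite !rmorphM /= xE; have [->|/yy->] := eqVneq (A j k) 0; ring.
by rewrite pr_delta mulr0.
Qed.

Lemma bform_root_le2 x y : is_root x -> is_root y -> bform x y <= 2.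
Proof.
rewrite /is_root => rx ry; have := bform_ge0 (x - y).
by rewrite !bformE rx ry (bformC y x); lia.
Qed.

Lemma bform_root_geN2 x y : is_root x -> is_root y -> -2 <= bform x y.
Proof. by move=> rx /root_opp ry; have := bform_root_le2 rx ry; rewrite bformE; lia. Qed.

(** The difference [x - y] has norm 0. This pins down the roots with extremal pairings, as
    [root_pr2], [root_prN2] and [root_pr11] record. *)
Lemma bform_root_eq2 x y : is_root x -> is_root y -> bform x y = 2 ->
  exists p : int, x = delta *~ p + y.
Proof.
rewrite /is_root => rx ry xy; have [|p hp] := @bform_eq0 (x - y).
  by rewrite !bformE rx ry (bformC y x) xy.
by exists p; rewrite -hp subrK.
Qed.

Lemma root_delta p x : is_root x -> is_root (delta *~ p + x).
Proof.
have d0 y : bform delta y = 0 by rewrite /bform big1 // => k _; rewrite pr_delta mulr0.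
by rewrite /is_root !bformE !d0 bformC d0 => ->; ring.
Qed.

Lemma root_pr_bound x i : is_root x -> -2 <= pr x i <= 2.
Proof.
move=> rx; rewrite -bform_unitv bform_root_le2 ?bform_root_geN2 //; exact: root_unitv.
Qed.

Lemma root_sum i k : A i k = -1 -> is_root (e i + e k).
Proof. by rewrite /is_root => h; rewrite !bformE (cartanC L k) !cartan_diag h. Qed.

Lemma root_pr2_bound x i k : A i k = -1 -> is_root x -> -2 <= pr x i + pr x k <= 2.
Proof.
move=> /root_sum r rx; rewrite -!bform_unitv -bformDr.
by rewrite bform_root_le2 ?bform_root_geN2.
Qed.

Lemma root_pr2 x i : is_root x -> pr x i = 2 -> exists p : int, x = delta *~ p + e i.
Proof. by move=> rx h; apply: bform_root_eq2 => //; rewrite ?bform_unitv //; exact: root_unitv. Qed.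

Lemma root_prN2 x i : is_root x -> pr x i = -2 -> exists p : int, x = delta *~ p - e i.
Proof.
move=> rx h; apply: bform_root_eq2 => //; last by rewrite !bformE h.
exact/root_opp/root_unitv.
Qed.

Lemma root_pr11 x i k : is_root x -> A i k = -1 -> pr x i = 1 -> pr x k = 1 ->
  exists p : int, x = delta *~ p + (e i + e k).
Proof.
move=> rx ik h1 h2; apply: bform_root_eq2 => //; first exact: root_sum.
by rewrite bformDr !bform_unitv h1 h2.
Qed.

(** The diagram is connected because the radical has rank one: cutting [delta] down to a set closed
    under adjacency leaves a radical vector, hence a multiple of [delta], and a nonzero multiple has
    full support. *)
Lemma adj_connected (P : I -> Prop) i :
  P i -> (forall j k, A j k = -1 -> P j -> P k) -> forall j, P j.
Proof.
move=> Pi Padj; pose x : Q := [ffun j => if `[< P j >] then delta j else 0].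
have [|p xp] := radicalE (x := x) (a := L).
  move=> k; rewrite -/(pr x k); have [Pk|nPk] := pselect (P k).
    rewrite -(pr_delta k) /pr; apply: eq_bigr => j _; rewrite ffunE.
    case: asboolP => // nPj; have [jk|/(cartan_off L)[->|jk]] := eqVneq j k.
    - by case: nPj; rewrite jk.
    - by rewrite !mulr0.
    - by case: nPj; apply: Padj Pk; rewrite cartanC.
  rewrite /pr big1 // => j _; rewrite ffunE.
  case: asboolP => [Pj|]; last by rewrite mul0r.
  have [jk|/(cartan_off L)[->|jk]] := eqVneq j k; last 2 first.
  - by rewrite mulr0.
  - by case: nPk; apply: Padj jk Pj.
  by case: nPk; rewrite -jk.
have xE j := congr1 (fun y : Q => y j) xp.
move=> j; have := xE j; have := xE i; rewrite !ffunMzE !ffunE asboolT // => pi.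
case: asboolP => // _ /esym/eqP; rewrite mulf_eq0 (gt_eqF (delta_gt0 L j)) /= => /eqP p0.
by have := delta_gt0 L i; rewrite pi p0 mulr0 ltxx.
Qed.

Lemma delta_multiple_posv p x : x = delta *~ p -> posv x -> (exists i, x i = 0) -> x = 0.
Proof.
move=> -> _ [i]; rewrite ffunMzE => /eqP; rewrite mulf_eq0 gt_eqF //= => /eqP->.
exact: mulr0z.
Qed.

(** The positive and negative parts have disjoint supports, so their product is at most 0. Their
    norms are even and non-negative while [x] has norm 2, so one part has norm 0 and is a multiple
    of [delta]. If that part had full support, the other would be 0 and [x] would have norm 0. *)
Lemma root_posv_or_negv x : is_root x -> posv x \/ posv (- x).
Proof.
move=> rx; pose xp : Q := [ffun i => if 0 <= x i then x i else 0].
pose xn : Q := [ffun i => if 0 <= x i then 0 else - x i].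
have xE : x = xp - xn. apply/ffunP => i; rewrite !ffunE. case: ifP; lia.
have pp : posv xp by move=> i; rewrite ffunE; case: ifP; lia.
have pn : posv xn by move=> i; rewrite ffunE; case: ifP; lia.
have cross : bform xp xn <= 0.
  rewrite /bform; apply: sumr_le0 => k _; rewrite /pr big_distrr /=.
  apply: sumr_le0 => j _; have [|/(cartan_le0 (j := k))] := eqVneq j k.
    by move=> ->; rewrite !ffunE; case: ifP => _; rewrite ?mul0r ?mulr0.
  by have := pp j; have := pn k; nia.
have [z hz] := bform_even xp; have [z' hz'] := bform_even xn.
have := bform_ge0 xp; have := bform_ge0 xn.
move: rx; rewrite /is_root xE !bformE (bformC xn xp) => rx gn gp.
have [np|nn] : bform xp xp = 0 \/ bform xn xn = 0 by lia.
- right; have [p hp] := bform_eq0 np.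
  have [[i xi]|h] := pselect (exists i, xp i = 0).
    have -> : xp = 0 by apply: delta_multiple_posv hp pp _; exists i.
    by rewrite sub0r opprK.
  have xn0 : xn = 0.
    apply/ffunP => i; rewrite !ffunE; have : xp i <> 0 by move=> hi; apply: h; exists i.
    by rewrite ffunE; case: ifP; lia.
  by exfalso; move: rx; rewrite np xn0 !bform0r; lia.
- left; have [p hp] := bform_eq0 nn.
  have [[i xi]|h] := pselect (exists i, xn i = 0).
    have -> : xn = 0 by apply: delta_multiple_posv hp pn _; exists i.
    by rewrite subr0.
  have xp0 : xp = 0.
    apply/ffunP => i; rewrite !ffunE; have : xn i <> 0 by move=> hi; apply: h; exists i.
    by rewrite ffunE; case: ifP; lia.
  by move: rx; rewrite nn xp0 !bform0l; lia.
Qed.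

Lemma posv_opp_eq0 x : posv x -> posv (- x) -> x = 0.
Proof.
move=> p n; apply/ffunP => i; have := p i; have := n i; rewrite !ffunE => n_i p_i.
by apply/eqP; rewrite eq_le p_i -oppr_ge0 n_i.
Qed.

Lemma root_neq0 x : is_root x -> x <> 0.
Proof. by rewrite /is_root => + x0; rewrite x0 bform0r. Qed.

Lemma root_posv_supp1 k x : is_root x -> posv x -> (forall j, j != k -> x j = 0) -> x = e k.
Proof.
move=> rx px x0.
have xE : x = e k *~ x k.
  apply/ffunP => j; rewrite ffunMzE ffunE; have [->|kj] := eqVneq k j; first by rewrite mul1r.
  by rewrite mul0r x0 // eq_sym.
have := rx; rewrite /is_root {1 2}xE !bformE cartan_diag => xk2.
have xk1 : x k = 1 by have := px k; nia.
by rewrite xE xk1 mulr1z.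
Qed.

(** Only the coordinate at [k] changes, so a negative image would leave [x] supported at [k]. *)
Lemma posv_refl k x : is_root x -> posv x -> x <> e k -> posv (refl k x).
Proof.
move=> rx px xk; have [//|n] := root_posv_or_negv (root_refl k rx).
case: xk; apply: root_posv_supp1 => // j jk.
have := n j; rewrite !(ffunE, ffunMzE) eq_sym (negPf jk) mul0r oppr0 addr0 oppr_ge0.
by move=> xj; apply/eqP; rewrite eq_le xj px.
Qed.
Lemma bform_unitvl k x : bform (e k) x = pr x k.
Proof. by rewrite bformC bform_unitv. Qed.

Lemma bform_deltar x : bform x delta = 0.
Proof. by rewrite bformC /bform big1 // => k _; rewrite pr_delta mulr0. Qed.

Lemma bform_deltal x : bform delta x = 0.
Proof. by rewrite bformC bform_deltar. Qed.

Lemma rootE x : is_root x = (bform x x = 2).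
Proof. by []. Qed.

End AffineLattice.

Ltac vec := apply/ffunP => ?; rewrite !(ffunE, ffunMzE); ring.
Ltac prs := rewrite ?prE ?pr_delta ?cartan_diag; lia.
(** Norms, heights and pairings are all left to [lia], which neither unfolds [lattice_root] nor
    knows [cartanC]. This is why the proofs below put [bform L x x = 2] and the transposed entries
    of [A] in the context. *)
Ltac side := match goal with
  | |- lattice_root _ _ => rewrite rootE ?bformE ?bform_unitvl ?bform_deltal ?bform_deltar ?prE ?pr_delta ?cartan_diag; lia
  | |- is_true (height _ < height _) => rewrite ?(heightD, heightN, heightMz, height_unitv); lia
  | |- @eq {ffun _ -> _} _ _ => vec
  | |- _ => first [by [] | prs]
  end.

(** * Recursive determination of the coefficients *)

Section Families.
Variables (I : finType) (L : affine_cartan I) (R : comPzRingType).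
Variables (s : R) (F G : int -> R).

Local Notation A := (cartan L).
Local Notation delta := (delta L).
Local Notation Q := {ffun I -> int}.
Local Notation e := (@unitv I).
Local Notation pr := (pairing L).
Local Notation refl := (simple_refl L).
Local Notation is_root := (lattice_root L).
Implicit Types (x y z : Q) (i j k l : I) (g : I -> Q -> R).

Lemma refl_pr1 k x : pr x k = 1 -> refl k x = x - e k.
Proof. by rewrite /refl => ->; rewrite mulr1z. Qed.

Lemma cartan_cases i j : [\/ i = j, A i j = 0 | A i j = -1].
Proof.
have [->|/(cartan_off L)[]] := eqVneq i j; [exact: Or31|exact: Or32|exact: Or33].
Qed.

(* The values that the relations prescribe for [g i x] in terms of lower roots.
   The two sequences of parameters are [F] and [G]. *)
Inductive candidate g i x : R -> Prop :=
| Cand_far k of A i k = 0 & 0 < pr x k : candidate g i x (g i (refl k x))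
| Cand_up k of A i k = -1 & pr x i = 1 & pr x k = 0 :
    candidate g i x (g k (x - e i))
| Cand_flat k of A i k = -1 & pr x i = 0 & pr x k = 1 :
    candidate g i x (s * g k (x - e k - e i) + (1 - s) * g i (x - e k))
| Cand_down k of A i k = -1 & pr x i = -1 & pr x k = 1 :
    candidate g i x (s * g k (x - e k) + (1 - s) * g i (x - e k))
| Cand_top k of A i k = -1 & pr x i = 1 & pr x k = 1 :
    candidate g i x (s * g k (x - e i *~ 2 - e k) + (1 - s) * g i (x - e k))
| Cand_side k of A i k = -1 & pr x i = -1 & pr x k = 2 :
    candidate g i x (s * g k (x - e k *~ 2 - e i) + (1 - s) * g i (x - e k *~ 2))
| Cand_plus p of x = delta *~ p + e i : candidate g i x (F p)
| Cand_minus p k of A i k = -1 & x = delta *~ p - e i :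
    candidate g i x (G p + (g i (x - e k) + s * g k (x - e k))).

(** The second clause relates two values at the same root, so it cannot serve as a step of a
    recursion on the height and is kept apart from the candidates. *)
Definition consistent g x : Prop :=
  (forall i v, candidate g i x v -> g i x = v) /\
  (forall i k, A i k = -1 -> pr x i = 0 -> pr x k = 0 -> g i x = g k x).

Definition family g : Prop :=
  (forall i x, is_root x -> ~ posv x -> g i x = 0) /\
  (forall x, is_root x -> consistent g x).

(** Every candidate involves only roots lower than [x], which makes the recursion on the height
    legitimate. *)
Lemma candidate_ext g g' i x v : is_root x ->
  (forall j y, is_root y -> height y < height x -> g j y = g' j y) ->
  candidate g i x v -> candidate g' i x v.
Proof.
move=> rx gg'; have xx : bform L x x = 2 := rx.
case=> [k ik xk|k ik xi xk|k ik xi xk|k ik xi xk|k ik xi xk|k ik xi xk|p xp|p k ik xp];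
  try (have ki : A k i = A i k by rewrite cartanC).
- rewrite gg'; [exact: Cand_far|exact: root_refl|rewrite /simple_refl; side].
- by rewrite gg'; [exact: Cand_up|side..].
- by rewrite !gg'; [exact: Cand_flat|side..].
- by rewrite !gg'; [exact: Cand_down|side..].
- by rewrite !gg'; [exact: Cand_top|side..].
- by rewrite !gg'; [exact: Cand_side|side..].
- exact: Cand_plus.
- have xk : pr x k = 1 by rewrite xp; side.
  by rewrite !gg'; [exact: Cand_minus|side..].
Qed.

(** * Confluence of the relations at a root, given consistency below it *)

Section Confluence.
Variables (g : I -> Q -> R) (x : Q).
Hypothesis x_root : is_root x.
Hypothesis g_neg : forall i y, is_root y -> ~ posv y -> g i y = 0.
Hypothesis below : forall y, is_root y -> height y < height x -> consistent g y.

Lemma below_far1 y z i k : is_root y -> height y < height x ->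
  A i k = 0 -> pr y k = 1 -> z = y - e k -> g i y = g i z.
Proof.
move=> ry hy ik yk ->; rewrite -refl_pr1 //.
by apply: (proj1 (below ry hy)); apply: Cand_far; rewrite ?yk.
Qed.

Lemma below_far2 y z i k : is_root y -> height y < height x ->
  A i k = 0 -> pr y k = 2 -> z = y - e k *~ 2 -> g i y = g i z.
Proof.
move=> ry hy ik yk ->; rewrite -[in e k *~ 2]yk.
by apply: (proj1 (below ry hy)); apply: Cand_far; rewrite ?yk.
Qed.

Lemma below_up y z i k : is_root y -> height y < height x ->
  A i k = -1 -> pr y i = 1 -> pr y k = 0 -> z = y - e i -> g i y = g k z.
Proof. by move=> ry hy ik yi yk ->; apply: (proj1 (below ry hy)); exact: Cand_up. Qed.

Lemma below_flat y z z' i k : is_root y -> height y < height x ->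
  A i k = -1 -> pr y i = 0 -> pr y k = 1 -> z = y - e k -> z' = y - e k - e i ->
  g i y = s * g k z' + (1 - s) * g i z.
Proof. by move=> ry hy ik yi yk -> ->; apply: (proj1 (below ry hy)); exact: Cand_flat. Qed.

Lemma below_down y z i k : is_root y -> height y < height x ->
  A i k = -1 -> pr y i = -1 -> pr y k = 1 -> z = y - e k ->
  g i y = s * g k z + (1 - s) * g i z.
Proof. by move=> ry hy ik yi yk ->; apply: (proj1 (below ry hy)); exact: Cand_down. Qed.

Lemma below_top y z z' i k : is_root y -> height y < height x ->
  A i k = -1 -> pr y i = 1 -> pr y k = 1 -> z = y - e k -> z' = y - e i *~ 2 - e k ->
  g i y = s * g k z' + (1 - s) * g i z.
Proof. by move=> ry hy ik yi yk -> ->; apply: (proj1 (below ry hy)); exact: Cand_top. Qed.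

Lemma below_side y z z' i k : is_root y -> height y < height x ->
  A i k = -1 -> pr y i = -1 -> pr y k = 2 -> z = y - e k *~ 2 ->
  z' = y - e k *~ 2 - e i ->
  g i y = s * g k z' + (1 - s) * g i z.
Proof. by move=> ry hy ik yi yk -> ->; apply: (proj1 (below ry hy)); exact: Cand_side. Qed.

Lemma below_plus y i p : is_root y -> height y < height x ->
  y = delta *~ p + e i -> g i y = F p.
Proof. by move=> ry hy yE; apply: (proj1 (below ry hy)); exact: Cand_plus. Qed.

Lemma below_equal y i k : is_root y -> height y < height x ->
  A i k = -1 -> pr y i = 0 -> pr y k = 0 -> g i y = g k y.
Proof. by move=> ry hy; apply: (proj2 (below ry hy)). Qed.

(** Orthogonal reflections commute. If [k] and [l] are adjacent, both pairings are 1 and the braid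
    relation leads from both sides to [x - e k *~ 2 - e l *~ 2]. *)
Lemma confluence_far_far i k l : A i k = 0 -> A i l = 0 -> 0 < pr x k -> 0 < pr x l ->
  g i (refl k x) = g i (refl l x).
Proof.
move=> ik il xk xl; have xx : bform L x x = 2 := x_root.
have [<-//|kl|kl] := cartan_cases k l; have lk : A l k = A k l by rewrite cartanC.
  have step j j' : A j j' = 0 -> A i j' = 0 -> 0 < pr x j -> 0 < pr x j' ->
      g i (refl j x) = g i (refl j' (refl j x)).
    move=> jj' ij' xj xj'; have r : is_root (refl j x) by exact: root_refl.
    have h : height (refl j x) < height x by rewrite /simple_refl; side.
    apply: (proj1 (below r h)); apply: Cand_far => //.
    by rewrite pr_refl jj' mul0r subr0.
  have lkC : refl k (refl l x) = refl l (refl k x).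
    by rewrite /simple_refl !prE kl lk kl; vec.
  by rewrite (step k l) // -lkC -step // lk.
have := root_pr2_bound kl x_root => b.
rewrite !refl_pr1; [|lia..].
have -> : g i (x - e k) = g i (x - e k - e l *~ 2) by apply: (below_far2 _ _ il); side.
have -> : g i (x - e l) = g i (x - e l - e k *~ 2) by apply: (below_far2 _ _ ik); side.
have -> : g i (x - e k - e l *~ 2) = g i (x - e k *~ 2 - e l *~ 2) by apply: (below_far1 _ _ ik); side.
have -> : g i (x - e l - e k *~ 2) = g i (x - e l *~ 2 - e k *~ 2) by apply: (below_far1 _ _ il); side.
congr (g i _); vec.
Qed.

Lemma pr_eq2 k : pr x k = 2 -> forall l, pr x l = A k l.
Proof.
by move=> /(root_pr2 x_root)[p ->] l; side.
Qed.

Lemma confluence_far_up i k l : A i l = 0 -> 0 < pr x l ->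
  A i k = -1 -> pr x i = 1 -> pr x k = 0 -> g i (refl l x) = g k (x - e i).
Proof.
move=> il xl0 ik xi xk; have xx : bform L x x = 2 := x_root.
have li : A l i = 0 by rewrite cartanC.
have ki : A k i = -1 by rewrite cartanC.
have xl : pr x l = 1.
  have := root_pr_bound l x_root; have [/pr_eq2 /(_ i)|] := eqVneq (pr x l) 2; lia.
rewrite refl_pr1 //.
have [kl|kl|kl] := cartan_cases k l; first by move: xk; rewrite kl xl.
  have lk : A l k = 0 by rewrite cartanC.
  have -> : g i (x - e l) = g k (x - e i - e l) by apply: below_up; side.
  by rewrite (@below_far1 (x - e i) (x - e i - e l) k l) //; side.
have lk : A l k = -1 by rewrite cartanC.
(* For a chain [i], [k], [l], the root [x - e l] has pairing 1 with both [i] and [k]. Each side then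
   reduces to [F p] and one and the same value of [g l]. *)
have [p xp] : exists p : int, x - e l = delta *~ p + (e i + e k).
  by apply: (@root_pr11 _ L) => //; side.
have -> : g i (x - e l) = s * g k (x - e l - e i *~ 2 - e k) + (1 - s) * g i (x - e l - e k).
  by apply: below_top; side.
have -> : g k (x - e i) = s * g l (x - e i - e k *~ 2 - e l) + (1 - s) * g k (x - e i - e l).
  by apply: below_top; side.
have -> : g i (x - e l - e k) = F p by apply: below_plus; first [side | rewrite xp; vec].
have -> : g k (x - e i - e l) = F p.
  by apply: below_plus; first [side | rewrite [x - e i - e l]addrAC xp; vec].
have -> : g k (x - e l - e i *~ 2 - e k) = g l (x - e l - e i *~ 2 - e k *~ 2).
  by apply: below_up; side.
have -> : g l (x - e i - e k *~ 2 - e l) = g l (x - e l - e i *~ 2 - e k *~ 2) by apply: (below_far1 _ _ li); side.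
by [].
Qed.

Lemma confluence_up_up i k l : A i k = -1 -> A i l = -1 ->
  pr x i = 1 -> pr x k = 0 -> pr x l = 0 -> g k (x - e i) = g l (x - e i).
Proof.
move=> ik il xi xk xl; have xx : bform L x x = 2 := x_root.
have ki : A k i = -1 by rewrite cartanC.
have li : A l i = -1 by rewrite cartanC.
have [->//|kl|kl] := cartan_cases k l.
  have lk : A l k = 0 by rewrite cartanC.
  have -> : g k (x - e i) = g k (x - e i - e l) by apply: (below_far1 _ _ kl); side.
  have -> : g l (x - e i) = g l (x - e i - e k) by apply: (below_far1 _ _ lk); side.
  have -> : g k (x - e i - e l) = g i (x - e i - e l - e k) by apply: below_up; side.
  have -> : g l (x - e i - e k) = g i (x - e i - e l - e k) by apply: below_up; side.
  by [].
(* This case is impossible: the pairing with [i] would be -1 on the left and -2 on the right. *)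
have [p xp] : exists p : int, x - e i = delta *~ p + (e k + e l).
  by apply: (@root_pr11 _ L) => //; side.
have := congr1 (pr^~ i) xp; rewrite /= !prE pr_delta cartan_diag; lia.
Qed.

Lemma pr_eq11 i k j : A i k = -1 -> pr x i = 1 -> pr x k = 1 -> pr x j = A i j + A k j.
Proof. by move=> ik xi xk; have [p ->] := root_pr11 x_root ik xi xk; side. Qed.

Lemma cartan_eq2 i j : A i j = 2 -> i = j.
Proof. by have [//|->|->] := cartan_cases i j. Qed.

Lemma pr_far_le1 i l : A l i = -1 -> pr x l = 1 -> forall m, A i m = 0 -> 0 < pr x m -> pr x m = 1.
Proof.
move=> lj xl m jm xm; have := root_pr_bound m x_root.
have [/pr_eq2 xm2|] := eqVneq (pr x m) 2; last by lia.
have := xm2 l; have [ml|->|->] := cartan_cases m l; [|lia..].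
by move: lj; rewrite -ml cartanC jm.
Qed.

Lemma confluence_far_flat i m l : A i m = 0 -> 0 < pr x m ->
  A i l = -1 -> pr x i = 0 -> pr x l = 1 ->
  g i (refl m x) = s * g l (x - e l - e i) + (1 - s) * g i (x - e l).
Proof.
move=> im xm0 il xi xl; have xx : bform L x x = 2 := x_root.
have mi : A m i = 0 by rewrite cartanC.
have li : A l i = -1 by rewrite cartanC.
have xm : pr x m = 1 by apply: (pr_far_le1 li).
rewrite refl_pr1 //.
have [lm|lm|lm] := cartan_cases l m; first by move: il; rewrite lm im.
  have ml : A m l = 0 by rewrite cartanC.
  have -> : g l (x - e l - e i) = g l (x - e l - e i - e m) by apply: (below_far1 _ _ lm); side.
  have -> : g i (x - e l) = g i (x - e l - e m) by apply: (below_far1 _ _ im); side.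
  by apply: below_flat; side.
by have := pr_eq11 i lm xl xm; lia.
Qed.

Lemma confluence_flat_flat i l m : A i l = -1 -> A i m = -1 ->
  pr x i = 0 -> pr x l = 1 -> pr x m = 1 ->
  s * g l (x - e l - e i) + (1 - s) * g i (x - e l) =
  s * g m (x - e m - e i) + (1 - s) * g i (x - e m).
Proof.
move=> il im xi xl xm; have xx : bform L x x = 2 := x_root.
have mi : A m i = -1 by rewrite cartanC.
have li : A l i = -1 by rewrite cartanC.
have [<-//|lm|lm] := cartan_cases l m; last by have := pr_eq11 i lm xl xm; lia.
have ml : A m l = 0 by rewrite cartanC.
(* One side is expanded until the result is invariant under exchanging [j] and [k]. The vectors [z]
   and [z'] are parameters so that both expansions share them literally and [ring] can compare the
   results. *)
have half j k z z' : A i j = -1 -> A i k = -1 -> A j i = -1 -> A k i = -1 ->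
    A j k = 0 -> A k j = 0 -> pr x j = 1 -> pr x k = 1 ->
    z = x - e j *~ 2 - e k *~ 2 - e i *~ 2 -> z' = x - e j - e k ->
  s * g j (x - e j - e i) + (1 - s) * g i (x - e j) =
  s * (s * g i z + (1 - s) * g j (x - e k *~ 2 - e j - e i *~ 2)) +
  (1 - s) * (s * g k (x - e j *~ 2 - e k - e i *~ 2) + (1 - s) * g i z').
  move=> ij ik ji ki jk kj xj xk -> ->.
  have -> : g j (x - e j - e i) = g j (x - e j - e i - e k *~ 2) by apply: (below_far2 _ _ jk); side.
  have -> : g j (x - e j - e i - e k *~ 2) = s * g i (x - e j *~ 2 - e k *~ 2 - e i *~ 2) +
       (1 - s) * g j (x - e k *~ 2 - e j - e i *~ 2) by apply: below_flat; side.
  have -> : g i (x - e j) = s * g k (x - e j - e i *~ 2 - e k) + (1 - s) * g i (x - e j - e k).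
    by apply: below_top; side.
  have -> : g k (x - e j - e i *~ 2 - e k) = g k (x - e j *~ 2 - e k - e i *~ 2) by apply: (below_far1 _ _ kj); side.
  by [].
rewrite (half l m (x - e l *~ 2 - e m *~ 2 - e i *~ 2) (x - e l - e m)) //.
rewrite (half m l (x - e l *~ 2 - e m *~ 2 - e i *~ 2) (x - e l - e m)) //; [ring|vec..].
Qed.

(** In the chain [i], [l], [m], both sides become combinations of values at [y] and [y - e i], where
    [y] is the image of [x] under the longest element for [l] and [m]. *)
Lemma confluence_far_down i m l : A i m = 0 -> 0 < pr x m ->
  A i l = -1 -> pr x i = -1 -> pr x l = 1 ->
  g i (refl m x) = s * g l (x - e l) + (1 - s) * g i (x - e l).
Proof.
move=> im xm0 il xi xl; have xx : bform L x x = 2 := x_root.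
have mi : A m i = 0 by rewrite cartanC.
have li : A l i = -1 by rewrite cartanC.
have xm : pr x m = 1 by apply: (pr_far_le1 li).
rewrite refl_pr1 //.
have [lm|lm|lm] := cartan_cases l m; first by move: il; rewrite lm im.
  have ml : A m l = 0 by rewrite cartanC.
  have -> : g l (x - e l) = g l (x - e l - e m) by apply: (below_far1 _ _ lm); side.
  have -> : g i (x - e l) = g i (x - e l - e m) by apply: (below_far1 _ _ im); side.
  by apply: below_down; side.
have ml : A m l = -1 by rewrite cartanC.
(* Here [x = p delta + e l + e m]. *)
pose y := x - e l *~ 2 - e m *~ 2.
have -> : g i (x - e m) = s * g l (x - e m - e l *~ 2 - e i) + (1 - s) * g i (x - e m - e l *~ 2).
  by apply: below_side; side.
have -> : g i (x - e l) = g i (x - e l - e m *~ 2) by apply: (below_far2 _ _ im); side.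
have -> : g l (x - e l) = s * g m (x - e l - e m *~ 2 - e l) + (1 - s) * g l (x - e l - e m *~ 2).
  by apply: below_side; side.
have -> : g i (x - e m - e l *~ 2) = g i y by apply: (below_far1 _ _ im); rewrite /y; side.
have -> : g i (x - e l - e m *~ 2) = s * g l (y - e i) + (1 - s) * g i y.
  by apply: below_flat; rewrite /y; side.
have -> : g l (x - e l - e m *~ 2) = g i y by apply: below_up; rewrite /y; side.
have -> : g l (x - e m - e l *~ 2 - e i) = s * g m (y - e i) + (1 - s) * g l (y - e i).
  by apply: below_down; rewrite /y; side.
have -> : g m (x - e l - e m *~ 2 - e l) = g m (y - e i).
  by apply: (below_far1 _ _ mi); rewrite /y; side.
ring.
Qed.

Lemma confluence_down_down i l m : A i l = -1 -> A i m = -1 ->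
  pr x i = -1 -> pr x l = 1 -> pr x m = 1 ->
  s * g l (x - e l) + (1 - s) * g i (x - e l) =
  s * g m (x - e m) + (1 - s) * g i (x - e m).
Proof.
move=> il im xi xl xm; have xx : bform L x x = 2 := x_root.
have mi : A m i = -1 by rewrite cartanC.
have li : A l i = -1 by rewrite cartanC.
have [<-//|lm|lm] := cartan_cases l m; last by have := pr_eq11 i lm xl xm; lia.
have ml : A m l = 0 by rewrite cartanC.
(* The expansion is again symmetric in [j] and [k]. *)
have half j k z z' : A i j = -1 -> A i k = -1 -> A j i = -1 -> A k i = -1 ->
    A j k = 0 -> A k j = 0 -> pr x j = 1 -> pr x k = 1 ->
    z = x - e j - e k -> z' = z - e i ->
  s * g j (x - e j) + (1 - s) * g i (x - e j) =
  s * (s * g i z' + (1 - s) * g j z') + (1 - s) * (s * g k z' + (1 - s) * g i z).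
  move=> ij ik ji ki jk kj xj xk -> ->.
  have -> : g j (x - e j) = g j (x - e j - e k) by apply: (below_far1 _ _ jk); side.
  have -> : g j (x - e j - e k) = s * g i (x - e j - e k - e i) +
       (1 - s) * g j (x - e j - e k - e i) by apply: below_down; side.
  have -> : g i (x - e j) = s * g k (x - e j - e k - e i) + (1 - s) * g i (x - e j - e k).
    by apply: below_flat; side.
  by [].
rewrite (half l m (x - e l - e m) (x - e l - e m - e i)) //.
rewrite (half m l (x - e l - e m) (x - e l - e m - e i)) //; [ring|vec].
Qed.

(** The sum has norm 6 - 6 = 0, so it is a multiple of [delta]; its coordinate 1 at [i] forces the
    multiplier to be 1. *)
Lemma triangle_delta i j k : A i j = -1 -> A j k = -1 -> A i k = -1 ->
  delta = e i + e j + e k.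
Proof.
move=> ij jk ik.
have ji : A j i = -1 by rewrite cartanC.
have kj : A k j = -1 by rewrite cartanC.
have ki : A k i = -1 by rewrite cartanC.
have neq a b : A a b = -1 -> (a == b) = false.
  by move=> ab; apply/eqP => abE; move: ab; rewrite abE cartan_diag.
have [|p hp] := @bform_eq0 _ L (e i + e j + e k).
  by rewrite ?bformE ?prE ?cartan_diag; lia.
have := congr1 (fun y : Q => y i) hp; rewrite !(ffunE, ffunMzE) eqxx (neq j i) // (neq k i) //.
rewrite !addr0 => dp; have := delta_gt0 L i => d0.
have p1 : p = 1 by nia.
by rewrite hp p1 mulr1z.
Qed.

Lemma height_delta_gt0 (i : I) : 0 < height delta.
Proof.
rewrite /height (bigD1 i) //= ltr_pwDl ?delta_gt0 // sumr_ge0 // => j _.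
exact/ltW/delta_gt0.
Qed.

Lemma posv_delta_le p y (a : I) : posv (delta *~ p + y) -> y a <= 0 -> 0 <= p.
Proof.
move=> /(_ a); rewrite ffunE ffunMzE => dp ya; have : 0 <= delta a * p by apply: le_trans dp _; rewrite gerDl.
by rewrite pmulr_rge0 ?delta_gt0.
Qed.

(* In type A2~ the relations decouple, and all the values at [q delta - e b]
   coincide, as well as all the values at [q delta + e b]. *)
Lemma triangle_values i j k (q : int) : A i j = -1 -> A j k = -1 -> A i k = -1 ->
  height delta * q + 1 < height x ->
  exists v w, forall a b c, A a b = -1 -> A b c = -1 -> A a c = -1 ->
    g a (delta *~ q - e b) = v /\ g a (delta *~ q + e b) = w.
Proof.
move=> ij jk ik; have hd := height_delta_gt0 i.
(* For negative [q'] both vectors have a negative coordinate at [a], which differs from [b]. *)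
have base q' : q' < 0 -> exists v w, forall a b c, A a b = -1 -> A b c = -1 -> A a c = -1 ->
    g a (delta *~ q' - e b) = v /\ g a (delta *~ q' + e b) = w.
  move=> q0; exists 0, 0 => a b c ab _ _.
  have ba : (b == a) = false by apply/eqP => abE; move: ab; rewrite abE cartan_diag.
  split; apply: g_neg; try side.
    by move=> /(@posv_delta_le _ _ a); rewrite !ffunE ba => /(_ isT); lia.
  by move=> /(@posv_delta_le _ _ a); rewrite !ffunE ba => /(_ isT); lia.
have [n] : exists n : nat, q < n%:Z by exists `|q|%N.+1; lia.
elim: n q => [|n IHn] q qn hq; first by apply: base; lia.
have [|q0] := ltP q 0; first exact: base.
have [||v [w vw]] := IHn (q - 1); [lia|nia|].
(* The first witness comes from [below_top] at [delta *~ q - e b], which meets [v] and [F (q - 1)].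
   The second comes from [below_side] at [delta *~ q + e b], which meets [w] and the first
   witness. *)
exists (s * v + (1 - s) * F (q - 1)),
  (s * w + (1 - s) * (s * v + (1 - s) * F (q - 1))) => a b c ab bc ac.
have ba : A b a = -1 by rewrite cartanC.
have cb : A c b = -1 by rewrite cartanC.
have ca : A c a = -1 by rewrite cartanC.
have dq : delta *~ q = delta *~ (q - 1) + (e a + e b + e c).
  by rewrite -(triangle_delta ab bc ac); vec.
have minus : g a (delta *~ q - e b) = s * v + (1 - s) * F (q - 1).
  have -> : g a (delta *~ q - e b) = s * g c (delta *~ (q - 1) - e a) +
      (1 - s) * g a (delta *~ (q - 1) + e a).
    by apply: below_top; first [side | rewrite dq; vec].
  have [-> _] := vw c a b ca ab cb.
  by congr (_ + _ * _); apply: below_plus; first [side | nia].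
split=> //; rewrite -minus.
have -> : g a (delta *~ q + e b) = s * g b (delta *~ (q - 1) + e c) +
    (1 - s) * g a (delta *~ q - e b).
  by apply: below_side; first [side | rewrite dq; vec].
by have [_ ->] := vw b c a bc ca ba.
Qed.

Lemma confluence_minus_minus i j k p : A i j = -1 -> A i k = -1 ->
  x = delta *~ p - e i ->
  g i (x - e j) + s * g j (x - e j) = g i (x - e k) + s * g k (x - e k).
Proof.
move=> ij ik xE; have xx : bform L x x = 2 := x_root.
have ji : A j i = -1 by rewrite cartanC.
have ki : A k i = -1 by rewrite cartanC.
have xi : pr x i = -2 by rewrite xE; side.
have xj : pr x j = 1 by rewrite xE; side.
have xk : pr x k = 1 by rewrite xE; side.
have [<-//|jk|jk] := cartan_cases j k; have kj := jk; rewrite cartanC in kj.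
  have half l l' z : A i l = -1 -> A i l' = -1 -> A l i = -1 -> A l' i = -1 ->
      A l l' = 0 -> A l' l = 0 -> pr x l = 1 -> pr x l' = 1 -> z = x - e l - e l' ->
      g i (x - e l) + s * g l (x - e l) =
      s * g l' z + (1 - s) * g i z + s * g l z.
    move=> il il' li l'i ll' l'l xl xl' ->.
    have -> : g i (x - e l) = s * g l' (x - e l - e l') + (1 - s) * g i (x - e l - e l').
      by apply: below_down; side.
    by have -> : g l (x - e l) = g l (x - e l - e l') by apply: (below_far1 _ _ ll'); side.
  rewrite (half j k (x - e j - e k)) // (half k j (x - e j - e k)) //; [ring|vec].
have dE := triangle_delta ij jk ik.
(* In the triangle, [x - e j] and [x - e k] are [delta *~ (p - 1)] plus a simple root, and all four
   values in the goal are the common value [w]. *)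
have dp : delta *~ p = delta *~ (p - 1) + (e i + e j + e k) by rewrite -dE; vec.
have [|v [w vw]] := @triangle_values i j k (p - 1) ij jk ik.
  by rewrite xE dE !(heightD, heightN, heightMz, height_unitv); lia.
have -> : x - e j = delta *~ (p - 1) + e k by rewrite xE dp; vec.
have -> : x - e k = delta *~ (p - 1) + e j by rewrite xE dp; vec.
have [_ ->] := vw i k j ik kj ij; have [_ ->] := vw j k i jk ki ji.
by have [_ ->] := vw i j k ij jk ik; have [_ ->] := vw k j i kj ji ki.
Qed.

Lemma delta_coef_inj p q (i : I) y : delta *~ p + y = delta *~ q + y -> p = q.
Proof.
move=> /addIr /(congr1 (fun z : Q => z i)); rewrite !ffunMzE.
by apply: mulfI; rewrite gt_eqF ?delta_gt0.
Qed.

Lemma candidate_unique i v v' :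
  candidate g i x v -> candidate g i x v' -> v = v'.
Proof.
have sym k : A k i = A i k by rewrite cartanC.
have xF p : x = delta *~ p + e i ->
    pr x i = 2 /\ forall k, pr x k = A i k.
  by move=> ->; split=> [|k]; side.
have xG p : x = delta *~ p - e i ->
    pr x i = -2 /\ forall k, pr x k = - A i k.
  by move=> ->; split=> [|k]; side.
have far_F k p : A i k = 0 -> 0 < pr x k -> x = delta *~ p + e i -> False.
  by move=> ik xk /xF[_ /(_ k)]; lia.
have far_G k p : A i k = 0 -> 0 < pr x k -> x = delta *~ p - e i -> False.
  by move=> ik xk /xG[_ /(_ k)]; lia.
have far_side k l : A i k = 0 -> 0 < pr x k -> A i l = -1 -> pr x l = 2 -> False.
  move=> ik xk il /pr_eq2 xl; move: xk; rewrite xl.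
  by have [lk|->|->] := cartan_cases l k; [move: il; rewrite lk ik|..].
have far_top k l : A i k = 0 -> 0 < pr x k -> A i l = -1 -> pr x i = 1 -> pr x l = 1 -> False.
  move=> ik xk il xi xl; move: xk; rewrite (pr_eq11 k il xi xl) ik add0r.
  by have [lk|->|->] := cartan_cases l k; [move: il; rewrite lk ik|..].
have up_top k l : A i k = -1 -> pr x k = 0 -> A i l = -1 -> pr x i = 1 -> pr x l = 1 -> False.
  move=> ik xk il xi xl; have := pr_eq11 k il xi xl; rewrite xk ik.
  by have [lk|->|->] := cartan_cases l k; [rewrite lk cartan_diag|..].
have down_side k l : pr x k = 1 -> pr x l = 2 -> False.
  move=> xk /pr_eq2/(_ k); rewrite xk; have [->|->|->] := cartan_cases l k => //.
  by rewrite cartan_diag.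
(* Of the 64 pairs of constructors, the incompatible pairings listed above exclude all but 14; these
   are the confluences proved before, their mirror images, and pairs with equal data. *)
case=> [k ik xk|k ik xi xk|k ik xi xk|k ik xi xk|k ik xi xk|k ik xi xk|p xp|p k ik xp];
case=> [l il xl|l il xi' xl|l il xi' xl|l il xi' xl|l il xi' xl|l il xi' xl|q xq|q l il xq];
  try (have [xi1 xk1] := xF _ xp); try (have [xi2 xl2] := xF _ xq);
  try (have [xi3 xk3] := xG _ xp); try (have [xi4 xl4] := xG _ xq);
  try (exfalso; by [lia | apply: far_F ik xk xq | apply: far_F il xl xp
    | apply: far_G ik xk xq | apply: far_G il xl xp | apply: far_side il xl ik xk | apply: far_side ik xk il xl
    | apply: far_top il xl ik xi xk | apply: far_top ik xk il xi' xl
    | apply: up_top il xl ik xi xk | apply: up_top ik xk il xi' xl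
    | apply: down_side xk xl | apply: down_side xl xk]).
- exact: confluence_far_far.
- exact: confluence_far_up.
- exact: confluence_far_flat.
- exact: confluence_far_down.
- by rewrite (confluence_far_up il xl ik).
- exact: confluence_up_up.
- by rewrite (confluence_far_flat il xl ik).
- exact: confluence_flat_flat.
- by rewrite (confluence_far_down il xl ik).
- exact: confluence_down_down.
- have := pr_eq11 l ik xi xk; rewrite xl il => kl.
  by have /cartan_eq2-> : A k l = 2 by lia.
- by have := pr_eq2 xk l; rewrite xl => /esym/cartan_eq2->.
- by congr F; apply: (@delta_coef_inj _ _ i (e i)); rewrite -xp -xq.
- have pq : p = q by apply: (@delta_coef_inj _ _ i (- e i)); rewrite -xp -xq.
  by rewrite pq (confluence_minus_minus ik il xp).
Qed.

(** The relation [g i x = g k x] is obtained from a candidate common to [i] and [k], found by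
    descending along some [l] with positive pairing. *)
Lemma candidate_equal i k : posv x -> A i k = -1 -> pr x i = 0 -> pr x k = 0 ->
  exists2 v, candidate g i x v & candidate g k x v.
Proof.
move=> px ik xi xk; have xx : bform L x x = 2 := x_root.
have ki : A k i = -1 by rewrite cartanC.
(* The norm 2 of [x] is the sum of its non-negative coordinates times its pairings. *)
have [l xl] : exists l, 0 < pr x l.
  apply: contrapT => no; have : bform L x x <= 0.
    apply: sumr_le0 => l _; rewrite mulr_ge0_le0 // leNgt; apply/negP => xl.
    by apply: no; exists l.
  by rewrite xx.
have one_sided j j' : A j j' = -1 -> A j' j = -1 -> pr x j = 0 -> pr x j' = 0 ->
    A l j = -1 -> A l j' = 0 -> exists2 v, candidate g j x v & candidate g j' x v.
  move=> jj' j'j xj xj' lj lj'; have jl : A j l = -1 by rewrite cartanC.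
  have j'l : A j' l = 0 by rewrite cartanC.
  have xl1 : pr x l = 1.
    have := root_pr_bound l x_root.
    by have [/pr_eq2/(_ j)|] := eqVneq (pr x l) 2; lia.
  exists (g j' (refl l x)); last exact: Cand_far.
  rewrite refl_pr1 //.
  suff -> : g j' (x - e l) = s * g l (x - e l - e j) + (1 - s) * g j (x - e l).
    exact: Cand_flat.
  have -> : g j (x - e l) = g j' (x - e l - e j) by apply: below_up; side.
  have -> : g j' (x - e l) = s * g j (x - e l - e j - e j') + (1 - s) * g j' (x - e l - e j).
    by apply: below_flat; side.
  have -> : g l (x - e l - e j) = g l (x - e l - e j - e j') by apply: (below_far1 _ _ lj'); side.
  by have -> : g l (x - e l - e j - e j') = g j (x - e l - e j - e j') by apply: below_equal; side.
have [li|li|li] := cartan_cases l i; first by move: xl; rewrite li xi.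
  have [lk|lk|lk] := cartan_cases l k; first by move: xl; rewrite lk xk.
    have il : A i l = 0 by rewrite cartanC.
    have kl : A k l = 0 by rewrite cartanC.
    exists (g i (refl l x)); first exact: Cand_far.
    suff -> : g i (refl l x) = g k (refl l x) by exact: Cand_far.
    apply: below_equal; rewrite ?pr_refl ?li ?lk ?xi ?xk ?mul0r ?subrr //.
      exact: root_refl.
    by rewrite /simple_refl; side.
  by have [v] := one_sided k i ki ik xk xi lk li; exists v.
have [lk|lk|lk] := cartan_cases l k; first by move: xl; rewrite lk xk.
  exact: one_sided.
(* If [l] is adjacent to both, the pairing of [x] with [delta] is [pr x l], which is positive,
   although [delta] is in the radical. *)
have dE := triangle_delta li ik lk.
have : bform L x delta = 0 by rewrite bform_deltar.
by rewrite dE !bformDr !bform_unitv; lia.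
Qed.

End Confluence.

(* A candidate at [x] only involves values at roots of smaller height, so that
   any [n] exceeding the height of [x] gives the same value. *)
Fixpoint solution_upto (n : nat) : I -> Q -> R :=
  if n is n'.+1 then fun i x =>
    if `[< is_root x /\ posv x >] then xget 0 [set v | candidate (solution_upto n') i x v] else 0
  else fun _ _ => 0.

Definition solution i x : R := solution_upto `|height x|%N.+1 i x.

Lemma posv_height_ge0 x : posv x -> 0 <= height x.
Proof. by move=> px; apply: sumr_ge0. Qed.

Lemma solution_upto_stable n n' i x : height x < n%:Z -> height x < n'%:Z ->
  solution_upto n i x = solution_upto n' i x.
Proof.
elim: n n' i x => [|n IHn] [|n'] i x hn hn' //=; case: asboolP => // -[rx px];
  try by have := posv_height_ge0 px; lia.
have ext j y : height y < height x -> solution_upto n j y = solution_upto n' j y.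
  by move=> h; apply: IHn; lia.
congr (xget _ _); apply/seteqP; split=> v /=; apply: candidate_ext => // j y _ /ext //.
Qed.

Lemma solutionE i x : solution i x =
  if `[< is_root x /\ posv x >] then xget 0 [set v | candidate solution i x v] else 0.
Proof.
rewrite {1}/solution /=; case: asboolP => // -[rx px]; have h0 := posv_height_ge0 px.
have ext j y : height y < height x -> solution_upto `|height x|%N j y = solution j y.
  by move=> h; apply: solution_upto_stable; lia.
congr (xget _ _); apply/seteqP; split=> v /=; apply: candidate_ext => // j y _ /ext //.
Qed.

(** * Existence and uniqueness of the family with given parameters *)

Hypothesis F_neg : forall p : int, p < 0 -> F p = 0.
Hypothesis G_neg : forall p : int, p <= 0 -> G p = 0.

Lemma solution_neg i x : ~ posv x -> solution i x = 0.
Proof. by move=> px; rewrite solutionE asboolF // => -[]. Qed.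

(** This makes the value 0 at negative roots compatible with all relations. The bounds on [F] and
    [G] differ because at [p = 0] the root [delta *~ p + e i] is positive but [delta *~ p - e i] is
    not. *)
Lemma candidate_neg g i x v : (forall j y, ~ posv y -> g j y = 0) -> ~ posv x ->
  candidate g i x v -> v = 0.
Proof.
move=> g0 nx.
have low y z : x = y + z -> posv z -> ~ posv y.
  by move=> xyz pz py; apply: nx => j; rewrite xyz ffunE addr_ge0.
have pe k : posv (e k) by move=> j; rewrite ffunE.
have pe2 k : posv (e k *~ 2) by move=> j; rewrite ffunMzE mulr_ge0 ?pe.
have pD y z : posv y -> posv z -> posv (y + z) by move=> py pz j; rewrite ffunE addr_ge0.
case=> [k _ xk|k _ _ _|k _ _ _|k _ _ _|k _ _ _|k _ _ _|p xp|p k _ xp].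
- apply: g0; apply: (low _ (e k *~ pr x k)); first by rewrite /simple_refl subrK.
  by move=> j; rewrite ffunMzE mulr_ge0 ?pe ?ltW.
- by apply: g0; apply: (low _ (e i)) => //; vec.
- by rewrite !g0 ?mulr0 ?addr0 //; [apply: (low _ (e k))|apply: (low _ (e k + e i))]; auto; vec.
- by rewrite !g0 ?mulr0 ?addr0 //; apply: (low _ (e k)); auto; vec.
- by rewrite !g0 ?mulr0 ?addr0 //; [apply: (low _ (e k))|apply: (low _ (e i *~ 2 + e k))]; auto; vec.
- by rewrite !g0 ?mulr0 ?addr0 //; [apply: (low _ (e k *~ 2))|apply: (low _ (e k *~ 2 + e i))]; auto; vec.
- apply: F_neg; rewrite ltNge; apply/negP => p0; apply: nx; rewrite xp.
  by apply: pD => // j; rewrite ffunMzE mulr_ge0 // ltW ?delta_gt0.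
- rewrite !g0 ?mulr0 ?addr0; try by apply: (low _ (e k)); auto; vec.
  apply: G_neg; rewrite leNgt; apply/negP => p0; apply: nx; rewrite xp => j.
  rewrite !(ffunE, ffunMzE); have := delta_gt0 L j; case: (i == j) => /=; nia.
Qed.

Lemma family_solution : family solution.
Proof.
split=> [i x _|x rx]; first exact: solution_neg.
have [n] : exists n : nat, height x < n%:Z by exists `|height x|%N.+1; lia.
elim: n x rx => [|n IHn] x rx hx; have [px|nx] := pselect (posv x); last 1 first.
- split=> [i v /candidate_neg->//|i k *]; rewrite ?solution_neg //.
  by move=> j y; exact: solution_neg.
- by have := posv_height_ge0 px; lia.
- split=> [i v /candidate_neg->//|i k *]; rewrite ?solution_neg //.
  by move=> j y; exact: solution_neg.
have below y : is_root y -> height y < height x -> consistent solution y.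
  by move=> ry hy; apply: IHn => //; lia.
have sol0 i y : is_root y -> ~ posv y -> solution i y = 0 by move=> _; exact: solution_neg.
have solP i v : candidate solution i x v -> solution i x = v.
  move=> iv; rewrite solutionE asboolT //; apply: (candidate_unique rx sol0 below _ iv).
  by apply: (@xgetPex _ 0 [set v | candidate solution i x v]); exists v.
split=> // i k ik xi xk; have [v vi vk] := candidate_equal rx below px ik xi xk.
by rewrite (solP i v) // (solP k v).
Qed.

Lemma neighbour_exists i : exists k, A i k = -1.
Proof.
apply: contrapT => no; have := pr_delta L i.
rewrite /pairing (bigD1 i) //= big1 => [|k ki].
  by rewrite cartan_diag; have := delta_gt0 L i; lia.
have [|->|ik] := cartan_cases k i; last by case: no; exists k; rewrite cartanC.
  by move/eqP; rewrite (negPf ki).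
by rewrite mulr0.
Qed.

(** The pairings weighted by the positive [delta k] sum to 0. If none were positive, all would
    vanish and so would the norm. *)
Lemma root_descent x : is_root x -> exists k, 0 < pr x k.
Proof.
move=> rx; apply: contrapT => no.
have le0 k : pr x k <= 0 by rewrite leNgt; apply/negP => xk; apply: no; exists k.
have /eqP := sum_delta_pr L x; rewrite -oppr_eq0 -sumrN psumr_eq0 => [/allP x0|k _]; last first.
  by rewrite oppr_ge0 mulr_ge0_le0 // ltW ?delta_gt0.
have := rx; rewrite rootE /bform big1 // => k _.
have := x0 k (mem_index_enum k); rewrite /= oppr_eq0 mulf_eq0 gt_eqF ?delta_gt0 //= => /eqP->.
by rewrite mulr0.
Qed.

Lemma candidate_exists g i x : is_root x -> exists v, candidate g i x v.
Proof.
move=> rx; have bi := root_pr_bound i rx.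
have sym k : A k i = A i k by rewrite cartanC.
have [xi|xi2] := eqVneq (pr x i) 2.
  by have [p xp] := root_pr2 rx xi; exists (F p); exact: Cand_plus.
have [xi|xiN2] := eqVneq (pr x i) (-2).
  have [p xp] := root_prN2 rx xi; have [k ik] := neighbour_exists i.
  by eexists; exact: Cand_minus ik xp.
have [xi|xi] : pr x i <= 0 \/ pr x i = 1 by lia.
  have [k xk] := root_descent rx; have bk := root_pr_bound k rx.
  have [ki|ik|ik] := cartan_cases i k; first by move: xk; rewrite -ki; lia.
    by eexists; exact: Cand_far ik xk.
  have [xk2|xk1] : pr x k = 2 \/ pr x k = 1 by lia.
    have := pr_eq2 rx xk2 i; rewrite sym ik => xi'.
    by eexists; exact: Cand_side ik xi' xk2.
  have [xi0|xi1] : pr x i = 0 \/ pr x i = -1 by lia.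
    by eexists; exact: Cand_flat ik xi0 xk1.
  by eexists; exact: Cand_down ik xi1 xk1.
(* The remaining case is pairing 1 with [i]. Without a candidate, each other [k] satisfies
   [pr x k <= A k i], so the weighted sum of pairings is at most [delta i - delta i * 2], which is
   negative instead of 0. *)
apply: contrapT => no.
have dE : delta i * 2 + \sum_(k | k != i) delta k * A k i = 0.
  by rewrite -[in RHS](pr_delta L i) /pairing [in RHS](bigD1 i) //= cartan_diag.
have := sum_delta_pr L x; rewrite (bigD1 i) //= xi.
suff : \sum_(k | k != i) delta k * pr x k <= \sum_(k | k != i) delta k * A k i.
  have := delta_gt0 L i; move: dE.
  by move: (\sum_(k | k != i) delta k * A k i) (\sum_(k | k != i) delta k * pr x k) => a b; lia.
apply: ler_sum => k ki; rewrite ler_pM2l ?delta_gt0 //.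
have bk := root_pr_bound k rx.
have [ik|ik|ik] := cartan_cases i k; first by rewrite ik eqxx in ki.
  by rewrite sym ik leNgt; apply/negP => xk; apply: no; eexists; exact: Cand_far ik xk.
rewrite sym ik; have xk2 : pr x k <> 2 by move=> /(pr_eq2 rx)/(_ i); rewrite sym ik xi.
have xk0 : pr x k <> 0 by move=> xk; apply: no; eexists; exact: Cand_up ik xi xk.
have xk1 : pr x k <> 1 by move=> xk; apply: no; eexists; exact: Cand_top ik xi xk.
lia.
Qed.

Lemma family_unique g g' : family g -> family g' ->
  forall i x, is_root x -> g i x = g' i x.
Proof.
move=> [g0 gc] [g'0 g'c] i x rx.
have [px|nx] := pselect (posv x); last by rewrite g0 ?g'0.
have [n] : exists n : nat, height x < n%:Z by exists `|height x|%N.+1; lia.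
elim: n i x rx px => [|n IHn] i x rx px hx; first by have := posv_height_ge0 px; lia.
have [v gv] := candidate_exists g i rx.
rewrite (proj1 (gc x rx) i v gv); symmetry; apply: (proj1 (g'c x rx)).
apply: candidate_ext gv => // j y ry hy.
have [py|ny] := pselect (posv y); last by rewrite g0 ?g'0.
by apply: IHn => //; lia.
Qed.
End Families.

(** * Hecke relations *)

Section Hecke.
Variables (I : finType) (L : affine_cartan I) (R : comPzRingType) (s t : R).
Hypothesis st1 : s * t = 1.

Local Notation A := (cartan L).
Local Notation delta := (delta L).
Local Notation Q := {ffun I -> int}.
Local Notation e := (@unitv I).
Local Notation pr := (pairing L).
Local Notation refl := (simple_refl L).
Local Notation is_root := (lattice_root L).
Implicit Types (x y z : Q) (i j k l : I) (g : I -> Q -> R).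

(* The right action of the Hecke algebra generator [T_k], with
   [(T_k - 1) (T_k + t) = 0], on functions on the roots. *)
Definition hecke_act k (h : Q -> R) x : R :=
  if pr x k == 0 then h x
  else if 0 < pr x k then h (refl k x)
  else (1 - t) * h x + t * h (refl k x).

Definition hecke_family g : Prop :=
  (forall i x, is_root x -> ~ posv x -> g i x = 0) /\
  (forall i k x, is_root x ->
    (A i k = 0 -> hecke_act k (g i) x = g i x) /\
    (A i k = -1 -> hecke_act k (g i) x = hecke_act i (g k) x)).

Lemma hecke_act0 k h x : pr x k = 0 -> hecke_act k h x = h x.
Proof. by rewrite /hecke_act => ->; rewrite eqxx. Qed.

Lemma hecke_act_pos k h x y : 0 < pr x k -> y = x - e k *~ pr x k -> hecke_act k h x = h y.
Proof. by rewrite /hecke_act => xk ->; rewrite gt_eqF // xk. Qed.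

Lemma hecke_act_neg k h x y : pr x k < 0 -> y = x - e k *~ pr x k ->
  hecke_act k h x = (1 - t) * h x + t * h y.
Proof. by rewrite /hecke_act => xk ->; rewrite lt_eqF // ltNge ltW. Qed.

Lemma from_hecke a b c : a = (1 - t) * b + t * c -> c = s * a + (1 - s) * b.
Proof.
move=> ->; rewrite mulrDr !mulrA (_ : s * (1 - t) = s - s * t); last by ring.
by rewrite st1; ring.
Qed.

Lemma to_hecke a b c : c = s * a + (1 - s) * b -> a = (1 - t) * b + t * c.
Proof.
move=> ->; rewrite (_ : t * (s * a + (1 - s) * b) = (s * t) * a + t * b - (s * t) * b); last by ring.
by rewrite st1; ring.
Qed.

(** * Families satisfy the Hecke relations *)

Section ToHecke.
Variables (F G : int -> R) (g : I -> Q -> R).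
Hypothesis g_family : family L s F G g.

(** The Hecke relation is symmetric in [i] and [k], so one order of the two pairings suffices. The
    eight remaining patterns correspond to the candidates, each solved for the value that it
    involves. *)
Lemma hecke_act_adj i k x : is_root x -> A i k = -1 -> pr x k <= pr x i ->
  hecke_act k (g i) x = hecke_act i (g k) x.
Proof.
move=> rx ik ki_le; have xx : bform L x x = 2 := rx.
have ki : A k i = -1 by rewrite cartanC.
have bi := root_pr_bound i rx; have bk := root_pr_bound k rx.
have bik := root_pr2_bound ik rx.
have xi2 : pr x i = 2 -> pr x k = -1 by move=> /(root_pr2 rx)[p ->]; side.
have xk2 : pr x k = -2 -> pr x i = 1 by move=> /(root_prN2 rx)[p ->]; side.
(* Consistency holds at all roots here; the height bound is just large enough for the lemmas on
   lower roots to apply up to [x + e k *~ 2]. *)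
have bl y : is_root y -> height y < height (x + e k *~ 3) -> consistent L s F G g y.
  by move=> ry _; apply: (proj2 g_family).
have [[xi xk]|[[xi xk]|[[xi xk]|[[xi xk]|[[xi xk]|[[xi xk]|[[xi xk]|[xi xk]]]]]]]] :
   pr x i = 0 /\ pr x k = 0 \/ pr x i = 0 /\ pr x k = -1 \/ pr x i = 1 /\ pr x k = -1 \/
   pr x i = 1 /\ pr x k = 0 \/ pr x i = -1 /\ pr x k = -1 \/ pr x i = 1 /\ pr x k = 1 \/
   pr x i = 1 /\ pr x k = -2 \/ pr x i = 2 /\ pr x k = -1 by lia.
- by rewrite !hecke_act0 //; apply: (proj2 (proj2 g_family x rx)).
- rewrite (hecke_act0 _ xi) (@hecke_act_neg k _ x (x + e k)) ?xk //; last by vec.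
  by symmetry; apply/to_hecke/(below_down bl); side.
- rewrite (@hecke_act_pos i _ x (x - e i)) ?xi // (@hecke_act_neg k _ x (x + e k)) ?xk //; last by vec.
  by symmetry; apply/to_hecke/(below_flat bl); side.
- rewrite (@hecke_act_pos i _ x (x - e i)) ?xi // (hecke_act0 _ xk).
  by apply: (below_up bl); side.
- rewrite (@hecke_act_neg k _ x (x + e k)) ?xk //; last by vec.
  rewrite (@hecke_act_neg i _ x (x + e i)) ?xi //; last by vec.
  have rk : is_root (x + e k) by side.
  have xik : pr (x + e k) i = -2 by side.
  have [p xp] := root_prN2 rk xik.
  have -> : g i (x + e k) = G p + (g i x + s * g k x).
    have := proj1 (proj2 g_family (x + e k) _) i _ (Cand_minus _ _ _ _ ik xp).
    by rewrite addrK => -> //; side.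
  (* The roots [x + e k] and [x + e i] carry the same [p], so the same [G p] enters both sides, and
     [s * t = 1] makes them equal. *)
  have xp' : x + e i = delta *~ p - e k.
    by rewrite -[delta *~ p](subrK (e i)) -xp; vec.
  have -> : g k (x + e i) = G p + (g k x + s * g i x).
    have := proj1 (proj2 g_family (x + e i) _) k _ (Cand_minus _ _ _ _ ki xp').
    by rewrite addrK => -> //; side.
  rewrite !mulrDr !mulrA (mulrC t s) st1; ring.
- rewrite (@hecke_act_pos i _ x (x - e i)) ?xi // (@hecke_act_pos k _ x (x - e k)) ?xk //.
  have [p xp] := root_pr11 rx ik xi xk.
  have -> : g i (x - e k) = F p by apply: (below_plus bl); first [side|rewrite xp; vec].
  by have -> : g k (x - e i) = F p by apply: (below_plus bl); first [side|rewrite xp; vec].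
- rewrite (@hecke_act_pos i _ x (x - e i)) ?xi // (@hecke_act_neg k _ x (x + e k *~ 2)) ?xk //; last by vec.
  by symmetry; apply/to_hecke/(below_side bl); side.
- rewrite (@hecke_act_pos i _ x (x - e i *~ 2)) ?xi // (@hecke_act_neg k _ x (x + e k)) ?xk //; last by vec.
  by symmetry; apply/to_hecke/(below_top bl); side.
Qed.

Lemma family_hecke : hecke_family g.
Proof.
split=> [|i k x rx]; first exact: (proj1 g_family).
split=> ik; last first.
  have [le|/ltW le] := leP (pr x k) (pr x i); first exact: hecke_act_adj.
  by symmetry; apply: hecke_act_adj => //; rewrite cartanC.
have far y : is_root y -> 0 < pr y k -> g i y = g i (refl k y).
  by move=> ry yk; apply: (proj1 (proj2 g_family y ry)); exact: Cand_far.
rewrite /hecke_act; case: ltgtP => // xk; first by rewrite (far x).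
have -> : g i (refl k x) = g i x; last by ring.
rewrite -{2}(reflK L k x); apply: far; first exact: root_refl.
by rewrite pr_refl cartan_diag; lia.
Qed.
End ToHecke.

(** * Hecke families satisfy the recursive relations *)

Section FromHecke.
Variable g : I -> Q -> R.
Hypothesis g_hecke : hecke_family g.
Variables i0 j0 : I.
Hypothesis ij0 : A i0 j0 = -1.

Definition plus_coef i (p : int) : R := g i (delta *~ p + e i).

(** This is the relation [Cand_minus] solved for its parameter. *)
Definition minus_coef i k (p : int) : R :=
  g i (delta *~ p - e i) - (g i (delta *~ p - e i - e k) + s * g k (delta *~ p - e i - e k)).

Let adj_eq i k x : is_root x -> A i k = -1 -> hecke_act k (g i) x = hecke_act i (g k) x.
Proof. by move=> rx; apply: (proj2 (proj2 g_hecke i k x rx)). Qed.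

(** At [delta *~ p + e i + e k] both reflections descend, and the Hecke relation is exactly this
    equality. *)
Lemma plus_coef_adj i k p : A i k = -1 -> plus_coef i p = plus_coef k p.
Proof.
move=> ik; have ki : A k i = -1 by rewrite cartanC.
have rx : is_root (delta *~ p + e i + e k) by side.
have := adj_eq rx ik.
rewrite (@hecke_act_pos k _ _ (delta *~ p + e i)); [|side|]; last first.
  by rewrite [pr _ k](_ : _ = 1); [vec|side].
rewrite (@hecke_act_pos i _ _ (delta *~ p + e k)) //; first by side.
by rewrite [pr _ i](_ : _ = 1); [vec|side].
Qed.

Lemma plus_coefE i p : plus_coef i p = plus_coef i0 p.
Proof.
apply: (@adj_connected _ L (fun i => plus_coef i p = plus_coef i0 p) i0) => //.
by move=> j k jk <-; rewrite (plus_coef_adj p jk).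
Qed.

(** At [delta *~ p - e i - e k] both reflections ascend; multiplying the Hecke relation by [s] gives
    the equality. *)
Lemma minus_coef_sym i k p : A i k = -1 -> minus_coef i k p = minus_coef k i p.
Proof.
move=> ik; have ki : A k i = -1 by rewrite cartanC.
have rx : is_root (delta *~ p - e i - e k) by side.
have := adj_eq rx ik.
rewrite (@hecke_act_neg k _ _ (delta *~ p - e i)); [|side|]; last first.
  by rewrite [pr _ k](_ : _ = -1); [vec|side].
rewrite (@hecke_act_neg i _ _ (delta *~ p - e k)); [|side|]; last first.
  by rewrite [pr _ i](_ : _ = -1); [vec|side].
rewrite /minus_coef [delta *~ p - e k - e i]addrAC => /(congr1 ( *%R s)).
rewrite !mulrDr !mulrA st1 !mul1r !mulrBr mulr1 st1 => h.
apply/eqP; rewrite -subr_eq0; apply/eqP.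
move/eqP: h; rewrite -subr_eq0 => /eqP <-; ring.
Qed.

Let F := plus_coef i0.
Let G := minus_coef i0 j0.

(* Independence of the neighbour is an instance of confluence, hence needs the
   consistency below; independence of [i] follows by symmetry and connectedness. *)
Lemma minus_coefE (p : int) :
  (forall y j, is_root y -> height y < height (delta *~ p - e j) -> consistent L s F G g y) ->
  forall i k, A i k = -1 -> minus_coef i k p = G p.
Proof.
move=> below; have indep i j k : A i j = -1 -> A i k = -1 -> minus_coef i j p = minus_coef i k p.
  move=> ij ik; congr (_ - _).
  have rx : is_root (delta *~ p - e i) by side.
  apply: (confluence_minus_minus rx _ _ ij ik (erefl _)) => [j' y|y ry /below]; last exact.
  exact: (proj1 g_hecke).
move=> i; apply: (@adj_connected _ L (fun i => forall k, A i k = -1 -> minus_coef i k p = G p) i0).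
  by move=> k ik; apply: indep.
move=> j k jk jG l kl; have kj : A k j = -1 by rewrite cartanC.
by rewrite (indep k l j) // minus_coef_sym // jG.
Qed.

(** The candidates for [far] and [up] are Hecke relations at [x]. Those for [flat], [down], [top]
    and [side] are the relation at [refl k x], solved for [g i x] in [refl_eq]. *)
Lemma hecke_consistent x : is_root x ->
  (forall y, is_root y -> height y < height x -> consistent L s F G g y) ->
  consistent L s F G g x.
Proof.
move=> rx below; have xx : bform L x x = 2 := rx.
have refl_eq i k c : A i k = -1 -> 0 < pr x k -> hecke_act i (g k) (refl k x) = c ->
    g i x = s * c + (1 - s) * g i (refl k x).
  move=> ik xk <-; apply: from_hecke; rewrite -adj_eq //; last exact: root_refl.
  rewrite -[in g i x](reflK L k x); apply: hecke_act_neg => //.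
  by rewrite pr_refl cartan_diag; lia.
have refl1 k : pr x k = 1 -> refl k x = x - e k by exact: refl_pr1.
have refl2 k : pr x k = 2 -> refl k x = x - e k *~ 2 by rewrite /simple_refl => ->.
split=> [i v|i k ik xi xk]; last by have := adj_eq rx ik; rewrite !hecke_act0.
case=> [k ik xk|k ik xi xk|k ik xi xk|k ik xi xk|k ik xi xk|k ik xi xk|p xp|p k ik xp];
  try (have ki : A k i = -1 by rewrite cartanC).
- by have [/(_ ik) <- _] := proj2 g_hecke i k x rx; apply: hecke_act_pos.
- have := adj_eq rx ik; rewrite hecke_act0 // => ->.
  by apply: hecke_act_pos; rewrite xi.
- rewrite (refl_eq i k (g k (x - e k - e i))) ?refl1 ?xk //.
  have xi' : pr (x - e k) i = 1 by side.
  by apply: hecke_act_pos; rewrite xi'.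
- rewrite (refl_eq i k (g k (x - e k))) ?refl1 ?xk //.
  by apply: hecke_act0; side.
- rewrite (refl_eq i k (g k (x - e i *~ 2 - e k))) ?refl1 ?xk //.
  have xi' : pr (x - e k) i = 2 by side.
  by apply: hecke_act_pos; rewrite xi' //; vec.
- rewrite (refl_eq i k (g k (x - e k *~ 2 - e i))) ?refl2 ?xk //.
  have xi' : pr (x - e k *~ 2) i = 1 by side.
  by apply: hecke_act_pos; rewrite xi'.
- by rewrite xp -/(plus_coef i p) plus_coefE.
- have <- : minus_coef i k p = G p.
    apply: minus_coefE => // y j ry; rewrite xp in below; move=> hy; apply: below => //.
    by move: hy; rewrite !(heightD, heightN, height_unitv).
  by rewrite /minus_coef xp subrK.
Qed.

Lemma not_posv_minus i p y : p <= 0 -> y i <= 0 -> ~ posv (delta *~ p - e i + y).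
Proof.
move=> p0 yi /(_ i); rewrite !(ffunE, ffunMzE) eqxx; have := delta_gt0 L i => di h.
have : delta i * p <= 0 by rewrite mulr_ge0_le0 // ltW.
move=> dp; have lt0 : delta i * p - 1 + y i < 0 by lia.
by move: h; rewrite leNgt lt0.
Qed.

Lemma plus_coef_neg p : p < 0 -> F p = 0.
Proof.
move=> p0; apply: (proj1 g_hecke); first by side.
move=> /(@posv_delta_le _ _ _ _ j0); rewrite ffunE.
have /negPf-> : i0 != j0 by apply/eqP => ij; move: ij0; rewrite ij cartan_diag.
by move=> /(_ isT); lia.
Qed.

Lemma minus_coef_neg p : p <= 0 -> G p = 0.
Proof.
move=> p0; have ji0 : A j0 i0 = -1 by rewrite cartanC.
have z1 : g i0 (delta *~ p - e i0) = 0.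
  apply: (proj1 g_hecke); first by side.
  by rewrite -[_ - e i0]addr0; apply: not_posv_minus => //; rewrite ffunE.
have z2 k : g k (delta *~ p - e i0 - e j0) = 0.
  apply: (proj1 g_hecke); first by side.
  by apply: not_posv_minus => //; rewrite !ffunE oppr_le0.
by rewrite /G /minus_coef z1 !z2 mulr0 addr0 subr0.
Qed.

Lemma hecke_is_family : family L s F G g.
Proof.
have g0 := proj1 g_hecke.
have neg x : is_root x -> ~ posv x -> consistent L s F G g x.
  move=> rx nx; split=> [i v iv|i k *]; rewrite !g0 //.
  (* [candidate_neg] wants vanishing at all vectors that are not positive, whereas [g] is controlled
     at roots only; hence the truncation. *)
  pose g' i y := if `[< is_root y /\ posv y >] then g i y else 0.
  have : candidate L s F G g' i x v.
    apply: candidate_ext iv => // j y ry _; rewrite /g'; case: asboolP => // ny.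
    by rewrite g0 // => py; apply: ny.
  by move=> /candidate_neg ->//; [exact: plus_coef_neg|exact: minus_coef_neg|
    move=> j y ny; rewrite /g' asboolF // => -[]].
split=> // x rx; have [px|nx] := pselect (posv x); last exact: neg.
have [n] : exists n : nat, height x < n%:Z by exists `|height x|%N.+1; lia.
elim: n x rx px => [|n IHn] x rx px hx; first by have := posv_height_ge0 px; lia.
apply: hecke_consistent => // y ry hy.
have [py|ny] := pselect (posv y); last exact: neg.
by apply: IHn => //; lia.
Qed.
End FromHecke.
End Hecke.

(** * Roots and depth *)

Local Open Scope classical_set_scope.

Lemma nat_minP (B : set nat) : (exists n, B n) ->
  B (nat_min B) /\ forall j, B j -> (nat_min B <= j)%N.
Proof.
move=> [n Bn]; have exb : exists k, (fun k => `[< B k >]) k by exists n; apply/asboolP.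
have : exists k, [set k | B k /\ forall j, B j -> (k <= j)%N] k.
  case: (ex_minnP exb) => k /asboolP Bk mink; exists k; split=> // j Bj.
  by apply: mink; apply/asboolP.
exact: xgetPex.
Qed.

Section Embedding.
Variables (K : realType) (I : finType) (m : coxeter_matrix I).

Local Notation Q := {ffun I -> int}.
Local Notation alpha := (@simple_root K I).

Definition cartan_of (i j : I) : int :=
  if i == j then 2 else if m i j == 3%N then -1 else 0.

Definition emb (x : Q) : rootspace K I := [ffun i => (x i)%:~R].

(** This precedes the choice of a lattice because the lattice is built from it in
    [affine_lattice]. *)
Lemma form_cartan (x : Q) k :
  cox_form m (emb x) (alpha k) = (\sum_j x j * cartan_of j k)%:~R.
Proof.
rewrite form_simple rmorph_sum; apply: eq_bigr => j _.
rewrite ffunE rmorphM /= -form_simple2 /cartan_of; congr (_ * _).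
have := cox_m_small m j k; have := cox_m_diag m j k.
have [->|jk] := eqVneq j k => [[_ /(_ erefl) mjk] _|[diag _]].
  by rewrite form_m1.
rewrite !inE => /or3P[/eqP/diag/eqP|/eqP mjk|/eqP mjk]; first by rewrite (negPf jk).
  by rewrite mjk form_m2.
by rewrite mjk form_m3.
Qed.

Variable L : affine_cartan I.
Hypothesis cartanE : forall i j, cartan L i j = cartan_of i j.

Local Notation A := (cartan L).
Local Notation delta := (delta L).
Local Notation e := (@unitv I).
Local Notation pr := (pairing L).
Local Notation refl := (simple_refl L).
Local Notation is_root := (lattice_root L).
Implicit Types (x y z : Q) (i j k l : I) (u w : seq I).

Lemma emb_inj : injective emb.
Proof.
move=> x y xy; apply/ffunP => i; have /(congr1 (fun f : rootspace K I => f i)) := xy.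
by rewrite !ffunE => /intr_inj.
Qed.

Lemma embD x y : emb (x + y) = emb x + emb y.
Proof. by apply/ffunP => i; rewrite !ffunE rmorphD. Qed.

Lemma embN x : emb (- x) = - emb x.
Proof. by apply/ffunP => i; rewrite !ffunE rmorphN. Qed.

Lemma emb_unitv i : emb (e i) = alpha i.
Proof. by apply/ffunP => j; rewrite !ffunE; case: (i == j). Qed.

Lemma form_emb x k : cox_form m (emb x) (alpha k) = (pr x k)%:~R.
Proof. by rewrite form_cartan; under eq_bigr do rewrite -cartanE. Qed.

Lemma reflection_emb k x : reflection m k (emb x) = emb (refl k x).
Proof.
rewrite /reflection form_emb -emb_unitv; apply/ffunP => j.
by rewrite !ffunE ffunMzE ffunE rmorphD rmorphN rmorphM /= mulrC.
Qed.

Definition lact u x : Q := foldr refl x u.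

Lemma act_word_emb u x : act_word m u (emb x) = emb (lact u x).
Proof. by elim: u => //= i u ->; rewrite reflection_emb. Qed.

Lemma root_lact u x : is_root x -> is_root (lact u x).
Proof. by move=> rx; elim: u => //= i u; exact: root_refl. Qed.

Lemma roots_emb v : Defs.roots m v -> exists2 x, is_root x & v = emb x.
Proof.
move=> [w [i ->]]; rewrite /cox_act -emb_unitv act_word_emb.
by exists (lact (repr w) (e i)) => //; exact/root_lact/root_unitv.
Qed.

(** Reflecting in some [k] with positive pairing lowers the height and keeps [x] positive, until [x]
    is simple. *)
Lemma emb_roots x : is_root x -> posv x -> Defs.roots m (emb x).
Proof.
suff : is_root x -> posv x -> exists u i, emb x = act_word m u (alpha i).
  by move=> h rx px; have [u [i ->]] := h rx px; exists (word m u), i; rewrite actE.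
have [n] : exists n : nat, height x < n%:Z by exists `|height x|%N.+1; lia.
elim: n x => [|n IHn] x hx rx px; first by have := posv_height_ge0 px; lia.
have [k xk] := root_descent rx.
have [->|/eqP nk] := eqVneq x (e k); first by exists [::], k; rewrite emb_unitv.
have [|u [i ui]] := IHn (refl k x) _ (root_refl k rx) (posv_refl rx px nk).
  by rewrite /simple_refl heightD heightN heightMz height_unitv; lia.
by exists (k :: u), i; rewrite /= -ui reflection_emb reflK.
Qed.

Lemma pos_roots_emb x : pos_roots m (emb x) <-> is_root x /\ posv x.
Proof.
split=> [[/roots_emb[y ry /emb_inj xy] px]|[rx px]].
  split=> [|i]; first by rewrite xy.
  by have := px i; rewrite ffunE ler0z.
by split; [exact: emb_roots|move=> i; rewrite ffunE ler0z].
Qed.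

Lemma word_prod u : (\prod_(i <- u) cox_gen m i)%g = word m u.
Proof.
elim: u => [|i u IHu]; first by rewrite big_nil.
by rewrite big_cons IHu; exact: cox_mulE.
Qed.

Lemma cox_lengthP (w : coxeter_group m) :
  (exists2 u, size u = cox_length w & w = word m u) /\
  (forall u, w = word m u -> (cox_length w <= size u)%N).
Proof.
have [|[u su wu] min] := @nat_minP [set k | exists2 u : seq I,
    size u = k & w = (\prod_(i <- u) cox_gen m i)%g].
  by exists (size (repr w)), (repr w) => //; rewrite word_prod word_repr.
split; first by exists u; [exact: su|rewrite wu word_prod].
by move=> v wv; apply: min; exists v => //; rewrite word_prod.
Qed.

(* Locked, because unification would otherwise try to evaluate the depth. *)
Definition latdepth x : nat := locked (depth m (emb x)).

Lemma latdepthE x : latdepth x = depth m (emb x).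
Proof. by rewrite /latdepth -lock. Qed.

Lemma neg_roots_lact u x : is_root x ->
  neg_roots m (cox_act (word m u) (emb x)) <-> posv (- lact u x).
Proof.
move=> rx; rewrite actE act_word_emb /neg_roots /= -embN pos_roots_emb.
by split=> [[]//|p]; split=> //; exact/root_opp/root_lact.
Qed.

Lemma lact_rev u x : lact (rev u) (lact u x) = x.
Proof.
elim: u => //= i u IHu; rewrite rev_cons -cats1 /lact foldr_cat /=.
by rewrite -/(lact u x) reflK.
Qed.

Lemma latdepthP x : is_root x -> posv x ->
  (exists2 u, size u = latdepth x & posv (- lact u x)) /\
  (forall u, posv (- lact u x) -> (latdepth x <= size u)%N).
Proof.
move=> rx px; rewrite latdepthE; have [|[w xw lw] min] := @nat_minP [set cox_length w |
   w in [set w : coxeter_group m | neg_roots m (cox_act w (emb x))]].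
  have [w [i xE]] := emb_roots rx px.
  (* The inverse of [w] brings [x] back to the simple root [i], which the letter [i] then makes
     negative. *)
  exists (cox_length (word m (i :: rev (repr w)))); exists (word m (i :: rev (repr w))) => //.
  apply/(neg_roots_lact _ rx); move: xE; rewrite /cox_act -emb_unitv act_word_emb => /emb_inj ->.
  by rewrite /= lact_rev refl_unitv opprK => j; rewrite ffunE.
split=> [|u nu].
  have [[u su wE] _] := cox_lengthP w.
  exists u; first by rewrite su; exact: lw.
  by apply/(neg_roots_lact _ rx); rewrite -wE.
have [_ /(_ u erefl)] := cox_lengthP (word m u).
apply: leq_trans; apply: min; exists (word m u) => //.
exact/neg_roots_lact.
Qed.

Lemma lactD u x y : lact u (x + y) = lact u x + lact u y.
Proof.
elim: u => //= i u ->; rewrite /simple_refl prD.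
by apply/ffunP => j; rewrite !(ffunE, ffunMzE); ring.
Qed.

Lemma lactMz u x (n : int) : lact u (x *~ n) = lact u x *~ n.
Proof.
elim: u => //= i u ->; rewrite /simple_refl prMz.
by apply/ffunP => j; rewrite !(ffunE, ffunMzE); ring.
Qed.

Lemma lact_inj u : injective (lact u).
Proof. by elim: u => [x y //|i u IHu x y /(can_inj (reflK L i)) /IHu]. Qed.

Lemma bform_lact u x y : bform L (lact u x) (lact u y) = bform L x y.
Proof. by elim: u => //= i u IHu; rewrite bform_refl. Qed.

(** Conjugating the reflection in a root by [u] gives the reflection in its image. *)
Lemma lact_refl u r c y : lact u (e r) = e c ->
  lact u (refl r y) = refl c (lact u y).
Proof.
move=> ur; rewrite /simple_refl -mulNrz lactD lactMz -ur.
have -> : lact u (- e r) = - lact u (e r).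
  by rewrite -[- e r]mulrN1z lactMz mulrN1z.
by rewrite mulNrz -!bform_unitv -ur bform_lact.
Qed.

Lemma root_negv x : is_root x -> ~ posv x -> posv (- x).
Proof. by move=> /root_posv_or_negv[]. Qed.

Lemma posv_refl_neg k x : is_root x -> posv x -> posv (- refl k x) -> x = e k.
Proof.
move=> rx px nx; apply: contrapT => /(posv_refl rx px) px'.
exact: root_neq0 (root_refl k rx) (posv_opp_eq0 px' nx).
Qed.

(** This is the exchange condition. At the letter [c] where the image of [e r] turns negative, that
    image was [e c], so multiplying by [r] deletes this letter. *)
Lemma lact_exchange u r : posv (- lact u (e r)) ->
  exists2 w, (size w).+1 = size u & forall y, lact w y = lact u (refl r y).
Proof.
elim: u => [|c u IHu] /=.
  by move=> n; case: (root_neq0 (root_unitv L r)); apply: posv_opp_eq0 n => j; rewrite ffunE.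
have ru := root_lact u (root_unitv L r).
have [pu|/(root_negv ru)/IHu[w sw wE] _] := pselect (posv (lact u (e r))); last first.
  by exists (c :: w) => [|y]; rewrite /= ?sw ?wE.
move=> /(posv_refl_neg ru pu) ur; exists u => // y.
by rewrite (lact_refl _ ur) reflK.
Qed.

(* Brink and Howlett's argument: write a shortest word sending [x] to a negative
   root as [c :: u], so that [u] sends [x] to the simple root [e c], and apply
   [u], or [c] after the exchange of [u] with [r], to [refl r x]. *)
Lemma latdepth_lt r x : is_root x -> posv x -> x <> e r -> 0 < pr x r ->
  (latdepth (refl r x) < latdepth x)%N.
Proof.
move=> rx px xr xr0; have [[u su nu] _] := latdepthP rx px.
have rr := root_refl r rx; have pr_ := posv_refl rx px xr.
have [_ min'] := latdepthP rr pr_.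
rewrite -su; case: u su nu => [_ nu|c u /= su nu].
  by case: (root_neq0 rx); exact: posv_opp_eq0.
rewrite ltnS; have ru := root_lact u rx.
have [pu|/(root_negv ru) n] := pselect (posv (lact u x)); last first.
  by have [_ /(_ u n)] := latdepthP rx px; rewrite -su ltnn.
have uE := posv_refl_neg ru pu nu.
have rb := root_lact u (root_unitv L r).
have [pb|/(root_negv rb)/lact_exchange[w sw wE]] := pselect (posv (lact u (e r))); last first.
  rewrite -sw; apply: (min' (c :: w)); rewrite /= wE reflK uE refl_unitv opprK => j.
  by rewrite ffunE.
apply: min'; apply: (root_negv (root_lact u rr)) => p.
have lE : lact u (refl r x) = e c - lact u (e r) *~ pr x r.
  by rewrite /simple_refl -mulNrz lactD lactMz -[- e r]mulrN1z lactMz mulrN1z uE mulNrz.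
(* If [u] kept [refl r x] positive, the positive root [lact u (e r)] would be supported at [c],
   hence equal to [e c], the image of [x]; so [x] would be [e r]. *)
apply: xr; apply: (@lact_inj u); rewrite uE; symmetry.
apply: (root_posv_supp1 rb pb) => j jc; have := p j; rewrite lE !(ffunE, ffunMzE).
rewrite eq_sym (negPf jc) sub0r oppr_ge0 pmulr_lle0 // => bj.
by apply/eqP; rewrite eq_le bj pb.
Qed.

(** Depth comparisons thus become signs of pairings, and the rescaling by powers of [rho] changes by
    one factor at each reflection. *)
Lemma latdepth_refl r x : is_root x -> posv x -> x <> e r -> 0 < pr x r ->
  latdepth x = (latdepth (refl r x)).+1.
Proof.
move=> rx px xr xr0; apply/eqP; rewrite eqn_leq latdepth_lt // andbT.
have [[u su nu] _] := latdepthP (root_refl r rx) (posv_refl rx px xr).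
have [_ min] := latdepthP rx px.
have := min (rcons u r); rewrite size_rcons su; apply.
by rewrite /lact foldr_rcons.
Qed.
End Embedding.

(** * LK-families *)

Section LinearExtensionality.
Variables (R : comPzRingType) (V U : lmodType R) (h : V -> U).
Hypothesis h_lin : linear h.

Lemma lin0 : h 0 = 0.
Proof. by have := h_lin (-1) 0 0; rewrite scaler0 addr0 scaleN1r addNr. Qed.

Lemma linZ a v : h (a *: v) = a *: h v.
Proof. by have := h_lin a v 0; rewrite lin0 !addr0. Qed.

Lemma linD v w : h (v + w) = h v + h w.
Proof. by have := h_lin 1 v w; rewrite !scale1r. Qed.
End LinearExtensionality.

Lemma freemod_decomp (R : comPzRingType) (X : choiceType) (v : freemod R X) :
  exists s : seq X, v = \sum_(x <- s) (v x : R) *: basis_elt R x.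
Proof.
have /asboolP/finite_seqP[A hA] := valP v; exists (undup A).
apply: val_inj; apply/funext => y.
have sumE (s : seq X) : val (\sum_(x <- s) (v x : R) *: basis_elt R x) y =
    \sum_(x <- s) (v x : R) * (x == y)%:R.
  by elim: s => [|x s IHs]; rewrite ?big_nil // !big_cons -IHs.
rewrite sumE; have [yA|yA] := boolP (y \in undup A).
  rewrite (big_rem y) //= eqxx mulr1 big_seq big1 ?addr0 // => x.
  by rewrite mem_rem_uniq ?undup_uniq // => /andP[/negPf /= -> _]; rewrite mulr0.
rewrite big_seq big1 => [|x xA]; last first.
  by have [xy|_] := eqVneq x y; rewrite ?mulr0 //; rewrite -xy xA in yA.
apply: contrapT => vy; move: yA; rewrite mem_undup => /negP; apply.
by have : [set` A] y by rewrite -hA.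
Qed.

Lemma freemod_ext (R : comPzRingType) (X : choiceType) (U : lmodType R)
    (h h' : freemod R X -> U) : linear h -> linear h' ->
  (forall x, h (basis_elt R x) = h' (basis_elt R x)) -> h =1 h'.
Proof.
move=> hl hl' hh' v; have [s ->] := freemod_decomp v.
elim: s => [|x s IHs]; first by rewrite !big_nil (lin0 hl) (lin0 hl').
by rewrite !big_cons (linD hl) (linD hl') (linZ hl) (linZ hl') hh' IHs.
Qed.

Section LKHecke.
Variables (K : realType) (I : finType) (m : coxeter_matrix I) (L : affine_cartan I).
Hypothesis cartanE : forall i j, cartan L i j = cartan_of m i j.
Variables (R : comPzRingType) (ub uc ud : unit_elt R).

Local Notation b := (unit_val ub).
Local Notation c := (unit_val uc).
Local Notation d := (unit_val ud).
Local Notation b' := (unit_inv ub).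
Local Notation c' := (unit_inv uc).
Local Notation d' := (unit_inv ud).
Local Notation A := (cartan L).
Local Notation delta := (delta L).
Local Notation Q := {ffun I -> int}.
Local Notation e := (@unitv I).
Local Notation pr := (pairing L).
Local Notation refl := (simple_refl L).
Local Notation is_root := (lattice_root L).
Local Notation D := (latdepth K m).
Local Notation ev x := (evec m R (emb K x)).
Implicit Types (x y : Q) (i j k : I).

Definition hecke_s : R := d * d * b' * c'.
Definition hecke_t : R := b * c * d' * d'.
Definition rho : R := b * d'.
Definition rho' : R := d * b'.

Let bb : b * b' = 1. Proof. exact: unit_valV. Qed.
Let cc : c * c' = 1. Proof. exact: unit_valV. Qed.
Let dd : d * d' = 1. Proof. exact: unit_valV. Qed.

Lemma hecke_st : hecke_s * hecke_t = 1.
Proof. by rewrite /hecke_s /hecke_t; ring: bb cc dd. Qed.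

Lemma rho_exp n : rho ^+ n * rho' ^+ n = 1.
Proof. by rewrite -exprMn (_ : rho * rho' = 1) ?expr1n // /rho /rho'; ring: bb dd. Qed.

Lemma d_inj : injective ( *%R d).
Proof.
by move=> x y /(congr1 ( *%R d')); rewrite !mulrA (mulrC d') dd !mul1r.
Qed.

Lemma rho'_exp_inj n : injective ( *%R (rho' ^+ n)).
Proof.
by move=> x y /(congr1 ( *%R (rho ^+ n))); rewrite !mulrA rho_exp !mul1r.
Qed.

Lemma evec_pos x : is_root x -> posv x ->
  exists2 r : pos_root K m, val r = emb K x & ev x = basis_elt R r.
Proof.
move=> rx px; have hx : emb K x \in pos_roots m by apply/mem_set/pos_roots_emb.
by exists (exist (fun v => is_true (v \in pos_roots m)) _ hx); rewrite // /evec insubT.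
Qed.

Lemma evec_nonpos x : ~ (is_root x /\ posv x) -> ev x = 0.
Proof.
move=> nx; rewrite /evec insubF //; apply/negP => /set_mem.
by move=> /(pos_roots_emb K cartanE).
Qed.

Lemma pos_root_emb (r : pos_root K m) : exists x, [/\ is_root x, posv x & val r = emb K x].
Proof.
have /set_mem h := valP r; have [rr _] := h.
have [x _ xE] := roots_emb cartanE rr; exists x.
by have [] : is_root x /\ posv x by apply/(pos_roots_emb K cartanE); rewrite -xE.
Qed.

Lemma LKmod_ext (h h' : LKmod K m R -> R^o) : linear h -> linear h' ->
  (forall x, is_root x -> posv x -> h (ev x) = h' (ev x)) -> h =1 h'.
Proof.
move=> hl hl' hh'; apply: freemod_ext => // r.
have [x [rx px rE]] := pos_root_emb r; have [r' r'E rx'] := evec_pos rx px.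
have -> : r = r' by apply: val_inj; rewrite rE r'E.
by rewrite -rx' hh'.
Qed.

Lemma refl_eq_id k x : (refl k x == x) = (pr x k == 0).
Proof.
apply/eqP/eqP => [xk|xk]; last by rewrite /simple_refl xk mulr0z subr0.
have := congr1 (fun y => pr y k) xk; rewrite pr_refl cartan_diag; lia.
Qed.

Lemma phi_evec k x : is_root x -> posv x ->
  phi ub uc ud k (ev x) =
    if x == e k then 0 else if pr x k == 0 then d *: ev x
    else if 0 < pr x k then b *: ev (refl k x)
    else coef_a ub uc ud *: ev x + c *: ev (refl k x).
Proof.
move=> rx px; have [r rE xE] := evec_pos rx px; rewrite {1}xE.
rewrite /phi linear_ext_basis /phi_basis rE -emb_unitv (inj_eq (@emb_inj K I)).
have [//|/eqP xk] := eqVneq x (e k).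
rewrite (reflection_emb K cartanE) (inj_eq (@emb_inj K I)) refl_eq_id.
have [//|/eqP x0] := eqVneq (pr x k) 0; rewrite -!latdepthE.
have [xp|xn] := ltP 0 (pr x k).
  by rewrite (latdepth_refl K cartanE rx px xk xp) ltnNge leqnSn /= ltnSn.
have [pr_ rr] := (posv_refl rx px xk, root_refl k rx).
have rk : refl k x <> e k.
  move=> h; have := px k; rewrite -(reflK L k x) h refl_unitv !ffunE eqxx.
  by rewrite ler0N1.
have r0 : 0 < pr (refl k x) k by rewrite pr_refl cartan_diag; lia.
by have := latdepth_refl K cartanE rr pr_ rk r0; rewrite reflK => ->; rewrite ltnSn.
Qed.

(** Dividing by [rho ^+ D x] turns the coefficient [b] of a descent into [d], and the coefficient
    [c] of an ascent into [d * hecke_t]. *)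
Definition normalised (h : LKmod K m R -> R^o) x : R := rho' ^+ D x * h (ev x).

Lemma not_posv_opp_unitv k : ~ posv (- e k).
Proof. by move=> /(_ k); rewrite !ffunE eqxx ler0N1. Qed.

Lemma normalised_nonpos (h : LKmod K m R -> R^o) x : linear h -> ~ posv x -> normalised h x = 0.
Proof.
by move=> hl nx; rewrite /normalised evec_nonpos ?(lin0 hl) ?mulr0 // => -[].
Qed.

(** The exceptional rule that [phi] kills the simple root vector joins the general descent rule,
    because the value at [- e k] is 0. *)
Lemma phi_normalised (h : LKmod K m R -> R^o) k x : linear h -> is_root x -> posv x ->
  rho' ^+ D x * h (phi ub uc ud k (ev x)) =
  d * hecke_act L hecke_t k (normalised h) x.
Proof.
move=> hl rx px; rewrite phi_evec //.
have [->|/eqP xk] := eqVneq x (e k).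
  rewrite (@hecke_act_pos _ _ _ _ _ _ _ (refl k (e k))) ?pr_unitv ?cartan_diag //; last first.
    by rewrite /simple_refl pr_unitv cartan_diag.
  rewrite refl_unitv normalised_nonpos ?(lin0 hl) ?mulr0 //.
  exact: not_posv_opp_unitv.
rewrite /hecke_act; have [x0|x0] := eqVneq (pr x k) 0.
  by rewrite (linZ hl) /normalised mulrCA.
have [xp|xn] := ltP 0 (pr x k).
  rewrite (linZ hl) /normalised (latdepth_refl K cartanE rx px xk xp) exprS.
  move: (rho' ^+ _) (h _) => P v; rewrite -[b *: v]/(b * v) /rho'.
  by ring: bb.
have [pr_ rr] := (posv_refl rx px xk, root_refl k rx).
have rk : refl k x <> e k.
  by move=> h'; apply: (@not_posv_opp_unitv k); rewrite -(refl_unitv L) -h' reflK.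
have r0 : 0 < pr (refl k x) k by rewrite pr_refl cartan_diag; lia.
rewrite (linD hl) !(linZ hl) /normalised (latdepth_refl K cartanE rr pr_ rk r0) reflK exprS.
move: (rho' ^+ _) (h (ev x)) (h (ev (refl k x))) => P v w.
rewrite -[_ *: v]/(_ * v) -[_ *: w]/(_ * w) /coef_a /hecke_t /rho'.
by ring: bb dd.
Qed.

(** The only negative root made positive by [k] is [- e k], where [h (e k) = 0] is used. So the
    vanishing of an LK-family at other simple roots supplies the Hecke relations at negative
    roots. *)
Lemma hecke_act_nonpos k (h : Q -> R) x : (forall y, is_root y -> ~ posv y -> h y = 0) ->
  h (e k) = 0 -> is_root x -> ~ posv x -> hecke_act L hecke_t k h x = 0.
Proof.
move=> h0 hk rx nx; have hr : h (refl k x) = 0.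
  have [->|/eqP xk] := eqVneq x (- e k); first by rewrite refl_opp refl_unitv opprK.
  apply: h0; first exact: root_refl.
  have nk : - x <> e k by move=> h'; apply: xk; rewrite -h' opprK.
  have := posv_refl (root_opp rx) (root_negv rx nx) nk; rewrite refl_opp => n p.
  exact: root_neq0 (root_refl k rx) (posv_opp_eq0 p n).
rewrite /hecke_act h0 //.
by case: ifP => // _; case: ifP => //; rewrite hr !mulr0 addr0.
Qed.

Lemma cartan0 i k : A i k = 0 <-> m i k = 2%N.
Proof.
rewrite cartanE /cartan_of; have := cox_m_small m i k; have [mik mki] := cox_m_diag m i k.
rewrite !inE; have [ik|ik] := eqVneq i k; first by rewrite (mki ik).
by case/or3P=> /eqP mE; rewrite mE //; move: ik; rewrite mik ?eqxx.
Qed.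

Lemma cartanN1 i k : A i k = -1 <-> m i k = 3%N.
Proof.
rewrite cartanE /cartan_of; have := cox_m_small m i k; have [mik mki] := cox_m_diag m i k.
rewrite !inE; have [ik|ik] := eqVneq i k; first by rewrite (mki ik).
by case/or3P=> /eqP mE; rewrite mE //; move: ik; rewrite mik ?eqxx.
Qed.

Lemma LK_hecke (f : I -> LKmod K m R -> R^o) : LK_conditions ub uc ud f ->
  hecke_family L hecke_t (fun i => normalised (f i)).
Proof.
move=> [lf f1 f2 f3].
have simple i k : i <> k -> normalised (f i) (e k) = 0.
  by move=> ik; rewrite /normalised emb_unitv f1 // mulr0.
have zero i y : is_root y -> ~ posv y -> normalised (f i) y = 0.
  by move=> _; exact: normalised_nonpos.
split; first exact: zero.
move=> i k x rx; split=> ik.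
  have ik' : i <> k by move=> h; move: ik; rewrite h cartan_diag.
  have [px|nx] := pselect (posv x); last first.
    by rewrite zero // hecke_act_nonpos //; [exact: zero|exact: simple].
  apply: d_inj; rewrite -(phi_normalised k (lf i) rx px).
  have := congr1 (fun h : LKmod K m R -> R^o => h (ev x)) (f2 i k (proj1 (cartan0 i k) ik)).
  by rewrite /= => ->; rewrite /normalised mulrCA.
have ik' : i <> k by move=> h; move: ik; rewrite h cartan_diag.
have [px|nx] := pselect (posv x).
  apply: d_inj.
  apply: etrans (esym (phi_normalised k (lf i) rx px)) _.
  apply: etrans _ (phi_normalised i (lf k) rx px).
  exact: (congr1 (fun h : LKmod K m R -> R^o => rho' ^+ D x * h (ev x))
    (f3 i k (proj1 (cartanN1 i k) ik))).
rewrite hecke_act_nonpos //; [|exact: zero|exact: simple].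
rewrite hecke_act_nonpos //; [exact: zero|apply: simple; exact/nesym].
Qed.

(** The relation at [- e k] equates [hecke_t * g i (e k)] with a value at a negative root, and
    [hecke_t] is invertible. *)
Lemma hecke_simple g i k : hecke_family L hecke_t g -> i <> k -> g i (e k) = 0.
Proof.
move=> [g0 gh] ik.
have rk : is_root (- e k) by exact/root_opp/root_unitv.
have act : hecke_act L hecke_t k (g i) (- e k) = hecke_t * g i (e k).
  rewrite (@hecke_act_neg _ _ _ _ _ _ _ (e k)) ?prN ?pr_unitv ?cartan_diag //; last first.
    by apply/ffunP => j; rewrite !(ffunE, ffunMzE); ring.
  by rewrite g0 ?mulr0 ?add0r //; exact: not_posv_opp_unitv.
have : hecke_t * g i (e k) = 0.
  rewrite -act; have [ik'|ik'|ik'] := cartan_cases L i k => //.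
    by rewrite (proj1 (gh i k _ rk) ik') g0 //; exact: not_posv_opp_unitv.
  rewrite (proj2 (gh i k _ rk) ik').
  have ki : A k i = -1 by rewrite cartanC.
  rewrite (@hecke_act_pos _ _ _ _ _ _ _ (- e k - e i)); first last.
  - by rewrite prN pr_unitv ki mulr1z.
  - by rewrite prN pr_unitv ki.
  apply: g0; first by rewrite /lattice_root !bformE !cartan_diag ki ik'.
  by move=> /(_ k); rewrite !ffunE eqxx; case: (i == k).
by move=> /(congr1 ( *%R hecke_s)); rewrite mulrA hecke_st mul1r mulr0.
Qed.

(** Positive roots have integral coordinates, so [Num.floor] recovers them exactly. *)
Definition unemb (v : rootspace K I) : Q := [ffun j => Num.floor (v j)].

Lemma embK x : unemb (emb K x) = x.
Proof. by apply/ffunP => j; rewrite !ffunE intrKfloor. Qed.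

Definition LK_of (g : I -> Q -> R) (i : I) : LKmod K m R -> R^o :=
  linear_ext (fun r : pos_root K m => rho ^+ depth m (val r) * g i (unemb (val r)) : R^o).

Lemma LK_of_linear g i : linear (LK_of g i).
Proof. exact: linear_ext_linear. Qed.

Lemma LK_of_evec g i x : is_root x -> posv x -> LK_of g i (ev x) = rho ^+ D x * g i x.
Proof.
by move=> rx px; have [r rE ->] := evec_pos rx px; rewrite /LK_of linear_ext_basis rE embK latdepthE.
Qed.

Lemma normalised_LK_of g i x : hecke_family L hecke_t g -> is_root x ->
  normalised (LK_of g i) x = g i x.
Proof.
move=> [g0 _] rx; have [px|nx] := pselect (posv x); last first.
  by rewrite normalised_nonpos ?g0 //; exact: LK_of_linear.
by rewrite /normalised LK_of_evec // mulrA (mulrC (_ ^+ _)) rho_exp mul1r.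
Qed.

Lemma hecke_LK g : hecke_family L hecke_t g -> LK_conditions ub uc ud (LK_of g).
Proof.
move=> gh; have act i k x : is_root x ->
    hecke_act L hecke_t k (normalised (LK_of g i)) x = hecke_act L hecke_t k (g i) x.
  by move=> rx; rewrite /hecke_act !normalised_LK_of //; exact: root_refl.
have lin_phi i k : linear (LK_of g i \o phi ub uc ud k).
  by move=> a u v /=; rewrite /phi linear_ext_linear LK_of_linear.
have lin_d i : linear (d *: LK_of g i).
  move=> a u v; rewrite -![(d *: LK_of g i) _]/(d *: LK_of g i _) LK_of_linear.
  by rewrite scalerDr !scalerA (mulrC d).
split=> [i|i j ij|i j ij|i j ij]; first exact: LK_of_linear.
- rewrite -emb_unitv LK_of_evec; first by rewrite hecke_simple ?mulr0.
    exact: root_unitv.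
  by move=> k; rewrite ffunE.
- apply/funext/LKmod_ext; [exact: lin_phi|exact: lin_d|move=> x rx px].
  apply: (@rho'_exp_inj (D x)).
  apply: etrans (phi_normalised j (LK_of_linear g i) rx px) _.
  rewrite (act i j x rx) (proj1 (proj2 gh i j x rx)); last exact/cartan0.
  by rewrite -(normalised_LK_of i gh rx) /normalised mulrCA.
- apply/funext/LKmod_ext; [exact: lin_phi|exact: lin_phi|move=> x rx px].
  apply: (@rho'_exp_inj (D x)).
  apply: etrans (phi_normalised j (LK_of_linear g i) rx px) _.
  apply: etrans _ (esym (phi_normalised i (LK_of_linear g j) rx px)).
  rewrite (act i j x rx) (act j i x rx) (proj2 (proj2 gh i j x rx)) //.
  exact/cartanN1.
Qed.
End LKHecke.

(** * The map mu *)

Section Mu.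
Variables (K : realType) (I : finType) (m : coxeter_matrix I) (L : affine_cartan I).
Hypothesis cartanE : forall i j, cartan L i j = cartan_of m i j.
Variables (R : comPzRingType) (b c d : unit_elt R).
Variables (i0 j0 : I).
Hypothesis ij0 : cartan L i0 j0 = -1.

Local Notation A := (cartan L).
Local Notation delta := (delta L).
Local Notation e := (@unitv I).
Local Notation D := (latdepth K m).
Local Notation s := (hecke_s b c d).
Local Notation t := (hecke_t b c d).
Local Notation r := (rho b d).
Local Notation r' := (rho' b d).
Local Notation LK := (LK_family K m b c d).
Local Notation mu := (mu m b c d (emb K delta) i0 j0).

Definition values (f : LK) i x : R := normalised b d (LK_val f i) x.

Lemma LK_familyP (f : LK) : LK_conditions b c d (LK_val f).
Proof. by case: f => f /= /asboolP. Qed.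

Lemma values_hecke f : hecke_family L t (values f).
Proof. exact: (LK_hecke cartanE (LK_familyP f)). Qed.

Lemma value_evec (f : LK) i x : f i (evec m R (emb K x)) = r ^+ D x * values f i x.
Proof. by rewrite /values /normalised mulrA rho_exp mul1r. Qed.

Lemma emb_delta_shift p x : emb K delta *+ p + emb K x = emb K (delta *~ p + x).
Proof.
rewrite embD; congr (_ + _); apply/ffunP => j.
by rewrite ffunMnE !ffunE ffunMzE rmorphM /= -mulr_natr.
Qed.

Definition mu_coef (g : I -> {ffun I -> int} -> R) (n : nat) : R :=
  if odd n then minus_coef L s g i0 j0 n.+1./2 else plus_coef L g i0 n./2.

(** In the odd case the depth of [delta *~ p - e i0] is one more than that of
    [delta *~ p - e i0 - e j0]. The extra [rho] turns [c * d] into [b * c], and [d ^+ 2] is [b * c]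
    times [hecke_s]. *)
Definition mu_scale (n : nat) : R :=
  if odd n then r ^+ D (delta *~ n.+1./2 - e i0 - e j0) * (unit_val b * unit_val c)
  else r ^+ D (delta *~ n./2 + e i0).

Definition mu_scale_inv (n : nat) : R :=
  if odd n then r' ^+ D (delta *~ n.+1./2 - e i0 - e j0) * (unit_inv b * unit_inv c)
  else r' ^+ D (delta *~ n./2 + e i0).

Lemma mu_scaleK n : mu_scale n * mu_scale_inv n = 1.
Proof.
rewrite /mu_scale /mu_scale_inv; case: ifP => _; last exact: rho_exp.
by rewrite mulrACA rho_exp mul1r mulrACA !unit_valV mulr1.
Qed.

Lemma muE f n : mu f n = mu_scale n * mu_coef (values f) n.
Proof.
rewrite /Defs.mu /mu_scale /mu_coef; case: ifP => n_odd; last first.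
  by rewrite /mu_even -emb_unitv emb_delta_shift value_evec.
have : (0 < n.+1./2)%N by case: n n_odd.
move: n.+1./2 => p p0; rewrite /mu_odd -!emb_unitv -!embN -!addrA -embD !emb_delta_shift !value_evec !addrA.
set x := delta *~ p - e i0.
have rx : lattice_root L x by exact/root_delta/root_opp/root_unitv.
have px : posv x.
  move=> j; rewrite !(ffunE, ffunMzE); have := delta_gt0 L j => dj.
  by rewrite subr_ge0; apply: (@le_trans _ _ 1); [case: (_ == _)|nia].
have xj : pairing L x j0 = 1 by rewrite /x !prE pr_delta ij0; lia.
have xe : x <> e j0 by move=> h; move: xj; rewrite h pr_unitv cartan_diag.
rewrite (latdepth_refl K cartanE rx px xe) ?xj // refl_pr1 // exprS /minus_coef -/x.
move: (r ^+ _) (values f i0 x) (values f i0 (x - e j0)) (values f j0 (x - e j0)) => P v w z.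
rewrite /rho /hecke_s; have bb := unit_valV b; have cc := unit_valV c; have dd := unit_valV d.
by ring: bb cc dd.
Qed.

Lemma mu_linear : linear mu.
Proof.
move=> a f f'; apply/funext => n; rewrite -[RHS]/(a * mu f n + mu f' n).
have E i v : LK_val (a *: f + f') i v = a * f i v + f' i v by [].
rewrite /Defs.mu /mu_odd /mu_even; case: ifP => _; rewrite !E //.
move: (f i0 _) (f' i0 _) (f i0 _) (f' i0 _) (f j0 _) (f' j0 _) => v1 v2 v3 v4 v5 v6; ring.
Qed.

(** The sequence indexed by naturals covers [p >= 0] for the first coefficient and [p >= 1] for the
    second; at the other integers both vanish. *)
Lemma coef_eq (g g' : I -> {ffun I -> int} -> R) :
  hecke_family L t g -> hecke_family L t g' ->
  (forall n, mu_coef g n = mu_coef g' n) ->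
  plus_coef L g i0 = plus_coef L g' i0 /\ minus_coef L s g i0 j0 = minus_coef L s g' i0 j0.
Proof.
move=> hg hg' gg'; split; apply/funext => p.
  have [p0|p0] := ltP p 0; first by rewrite (plus_coef_neg hg ij0) // (plus_coef_neg hg' ij0).
  have := gg' `|p|%N.*2; rewrite /mu_coef odd_double doubleK.
  by rewrite gez0_abs.
have [p0|p0] := leP p 0; first by rewrite (minus_coef_neg s hg ij0) // (minus_coef_neg s hg' ij0).
have [n pE] : exists n : nat, p = n.+1%:Z by exists `|p|%N.-1; lia.
by have := gg' n.*2.+1; rewrite /mu_coef /= odd_double /= doubleK -pE.
Qed.

Lemma mu_inj : injective mu.
Proof.
move=> f f' ff'; have hf := values_hecke f; have hf' := values_hecke f'.
have [|plusE minusE] := coef_eq hf hf'.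
  move=> n; have := congr1 (fun a => mu_scale_inv n * a n) ff'.
  by rewrite /= !muE !mulrA (mulrC (mu_scale_inv n)) mu_scaleK !mul1r.
have famf := hecke_is_family (hecke_st b c d) hf ij0.
have := hecke_is_family (hecke_st b c d) hf' ij0; rewrite -plusE -minusE => famf'.
apply: val_inj; apply/funext => i; apply/funext; apply: (LKmod_ext cartanE).
- by have [lf _ _ _] := LK_familyP f; exact: lf.
- by have [lf _ _ _] := LK_familyP f'; exact: lf.
- by move=> x rx px; rewrite /= !value_evec (family_unique famf famf').
Qed.

Lemma mu_surj (a : nat -> R) : exists f, mu f = a.
Proof.
pose val n := mu_scale_inv n * a n.
(* The sequence is divided by the units of [mu_scale], read at index [2p] for [F] and [2p - 1] for
   [G], and extended by 0 as [family_solution] demands. *)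
pose F (p : int) := if p < 0 then 0 else val `|p|%N.*2.
pose G (p : int) := if p <= 0 then 0 else val `|p|%N.*2.-1.
have fam : family L s F G (solution L s F G).
  by apply: family_solution => p p0; rewrite /F /G p0.
have hg := family_hecke (hecke_st b c d) fam.
have hf : (LK_of b d (solution L s F G) : I -> LKmod K m R -> R^o) \in LK_pred b c d.
  by apply/asboolP; exact: (hecke_LK K cartanE hg).
exists (LKFamily hf); apply/funext => n; rewrite muE.
have -> : mu_coef (values (LKFamily hf)) n = val n; last by rewrite /val mulrA mu_scaleK mul1r.
have valE i x : lattice_root L x -> values (LKFamily hf) i x = solution L s F G i x.
  by move=> rx; exact: (normalised_LK_of K cartanE i hg rx).
have [plus minus] : lattice_root L (delta *~ n./2 + e i0) /\ lattice_root L (delta *~ n.+1./2 - e i0).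
  by split; apply: root_delta; [|apply: root_opp]; exact: root_unitv.
have rj : lattice_root L (delta *~ n.+1./2 - e i0 - e j0).
  by rewrite -addrA -opprD; apply/root_delta/root_opp/root_sum.
rewrite /mu_coef; case: ifP => n_odd.
  rewrite /minus_coef !valE // (proj1 (proj2 fam _ minus) _ _ (Cand_minus _ _ _ _ ij0 erefl)).
  rewrite addrK /G; have n0 : (0 < n.+1./2)%N by case: n n_odd {plus minus rj}.
  rewrite lt_geF ?ltz_nat //; congr val => /=.
  by have := odd_double_half n; rewrite n_odd; case: (n) n_odd => // n' /= _; lia.
rewrite /plus_coef valE // (proj1 (proj2 fam _ plus) _ _ (Cand_plus _ _ _ _ erefl)).
rewrite /F /=; congr val.
by have := odd_double_half n; rewrite n_odd.
Qed.

Lemma mu_bijective : bijective mu.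
Proof.
pose inv a := sval (cid (mu_surj a)); have invK a : mu (inv a) = a by exact: svalP (cid (mu_surj a)).
by exists inv => // f; apply: mu_inj; rewrite invK.
Qed.
End Mu.

(** * The lattice attached to the first imaginary root *)

Lemma dvdn_mul_biggcd (J : finType) (n : J -> nat) (q a : nat) :
  (forall j, q %| a * n j)%N -> (q %| a * \big[gcdn/0]_j n j)%N.
Proof.
move=> qa; apply: (big_ind (fun g => q %| a * g)%N) => [|g g' hg hg'|j _]; last exact: qa.
  by rewrite muln0 dvdn0.
by rewrite muln_gcdr dvdn_gcd hg.
Qed.

(** The radical is given over the reals, so an integral radical vector is a priori a real multiple
    of [delta]; coprimality makes the multiplier an integer. *)
Lemma affine_lattice (K : realType) (I : finType) (m : coxeter_matrix I)
    (del : rootspace K I) : first_imaginary_root m del ->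
  exists L : affine_cartan I,
    (forall i j, cartan L i j = cartan_of m i j) /\ del = emb K (delta L).
Proof.
move=> [n [n_gt0 gcd1 delE radE]]; pose dl : {ffun I -> int} := [ffun i => (n i)%:Z].
have delemb : del = emb K dl.
  apply/ffunP => j; rewrite delE sum_ffunE !ffunE (bigD1 j) //= big1 => [|i ij].
    by rewrite addr0 ffunMnE ffunE eqxx.
  by rewrite ffunMnE ffunE (negPf ij) mul0rn.
have symC i j : cartan_of m i j = cartan_of m j i.
  by rewrite /cartan_of eq_sym cox_m_sym.
have diag i : cartan_of m i i = 2 by rewrite /cartan_of eqxx.
have off i j : i != j -> cartan_of m i j = 0 \/ cartan_of m i j = -1.
  by move=> /negPf ij; rewrite /cartan_of ij; case: ifP; [right|left].
have pos i : 0 < dl i by rewrite ffunE ltz_nat.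
have rad k : \sum_j dl j * cartan_of m j k = 0.
  apply/eqP; rewrite -(intr_eq0 K) -form_cartan -delemb; apply/eqP.
  by have [_ ->] := radE del; last by exists 1; rewrite scale1r.
have radP (x : {ffun I -> int}) : (forall k, \sum_j x j * cartan_of m j k = 0) ->
    exists p : int, x = dl *~ p.
  move=> x0; have [] := proj1 (radE (emb K x)).
    move=> y; have -> : cox_form m (emb K x) y = \sum_k y k * cox_form m (emb K x) (simple_root K k).
      rewrite /cox_form exchange_big; apply: eq_bigr => k _ /=.
      rewrite -/(cox_form m (emb K x) (simple_root K k)) form_simple big_distrr.
      by apply: eq_bigr => i _ /=; ring.
    by rewrite big1 // => k _; rewrite form_cartan x0 mulr0.
  move=> q xq; have xE i : (x i)%:~R = q * (n i)%:R :> K.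
    have /(congr1 (fun v : rootspace K I => v i)) := xq.
    by rewrite delemb !ffunE.
  (* Eliminating the real [q] leaves integral equations: [n j] divides [x j * n i] for every [i],
     hence divides [x j] as the gcd of the [n i] is 1. *)
  have cross i j : x i * n j = x j * n i.
    apply/eqP; rewrite -(eqr_int K) !rmorphM /= !xE; apply/eqP.
    by rewrite -!pmulrn; ring.
  have dv j : (n j %| `|x j|)%N.
    rewrite -[`|x j|%N]muln1 -gcd1; apply: dvdn_mul_biggcd => i.
    have := congr1 absz (cross i j); rewrite !abszM /= => <-.
    exact: dvdn_mull.
  have [[i _]|noI] := pselect (exists i : I, True); last first.
    by exists 0; apply/ffunP => i; case: noI; exists i.
  have dvz j : exists z : int, x j = dl j * z.
    have /dvdzP[z ->] : (dl j %| x j)%Z by rewrite ffunE dvdzE dv.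
    by exists z; exact: mulrC.
  have [p xp] := dvz i; exists p; apply/ffunP => j; rewrite ffunMzE.
  have := cross i j; rewrite xp; have [z ->] := dvz j.
  rewrite !ffunE => h; congr (_ * _).
  have ni : (n i)%:Z != 0 by rewrite gt_eqF // ltz_nat.
  have nj : (n j)%:Z != 0 by rewrite gt_eqF // ltz_nat.
  by apply: (mulfI ni); apply: (mulfI nj); move: h; lia.
by exists (AffineCartan symC diag off pos rad radP).
Qed.

Theorem theorem35 (K : realType) (I : finType) (m : coxeter_matrix I)
    (m_affine : affine_ADE m) (R : comPzRingType) (b c d : unit_elt R)
    (delta : rootspace K I) (hdelta : first_imaginary_root m delta)
    (i0 j0 : I) (hij : m i0 j0 = 3%N) :
  linear (mu m b c d delta i0 j0)
  /\ bijective (mu m b c d delta i0 j0).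
Proof.
have [L [cartanE ->]] := affine_lattice hdelta.
have ij0 : cartan L i0 j0 = -1 by exact/(cartanN1 cartanE).
by split; [exact: mu_linear|exact: mu_bijective].
Qed.
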